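(* Suppose the driving sequence $\xi$ is i.i.d. Then $(\mathbf B_t)_{t\in\mathbb Z}$ is a Markov chain on $S_{\mathbf B}$. Additionally, $(\mathbf B_t)_{t\in\mathbb Z}$ is stationary and bi-recurrent for every $E\in S_{\mathbf B}$. Its transition matrix $P_{\mathbf B}$ is irreducible and positive recurrent. If $\mathbf G$ is a.s. connected with fully independent transitions and $p_{x^*,x^*}>0$, then $\{x^*\}\in S_{\mathbf B}$ and $P_{\mathbf B}(\{x^*\},\{x^*\})>0$, so $P_{\mathbf B}$ is aperiodic as well.
   Context: Doeblin graph. Let $(\Omega,\mathcal F,\mathbb P)$ be a probability space, $S$ a countable set, $\Xi$ a complete separable metric space, $h:S\times\Xi\to S$ a measurable map, and $\xi=(\xi_t)_{t\in\mathbb Z}$ the driving sequence of $\Xi$-valued random variables, here i.i.d. Put $p_{x,y}=\mathbb P(h(x,\xi_0)=y)$. The Doeblin graph $\mathbf G$ has vertex set $\mathbb Z\times S$ and a directed edge from each $(t,x)$ to $f_+(t,x):=(t+1,h(x,\xi_t))$. For $s\ge t$, $F^{(t,x)}_s\in S$ is defined by $(s,F^{(t,x)}_s)=f_+^{\,s-t}(t,x)$. Connectedness refers to the underlying undirected graph. $\mathbf G$ has fully independent transitions if $\xi$ is i.i.d. and for each $t\in\mathbb Z$ the family $(f_+(t,x))_{x\in S}$ is independent. A state $x$ is positive recurrent if $\mathbb E[\inf\{s>0:F^{(0,x)}_s=x\}]<\infty$. Bridge graph. Fix a positive recurrent state $x^*\in S$ (assumed to exist). The bridge graph $\mathbf B$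 is the subgraph of $\mathbf G$ with vertex set $V(\mathbf B)=\bigcup_{t\in\mathbb Z}\{(s,F^{(t,x^* )}_s):s\ge t\}$. Put $\mathbf B_t=\{y\in S:(t,y)\in V(\mathbf B)\}$ and $S_{\mathbf B}=\{E\subseteq S:\mathbb P(\mathbf B_0=E)>0\}$ (a countable collection of finite subsets of $S$). A process $(Y_t)_{t\in\mathbb Z}$ is bi-recurrent for a state $E$ if a.s. $\{t\in\mathbb Z:Y_t=E\}$ is unbounded above and below. *)

(* Defs.v *)
From HB Require Import structures.
From mathcomp Require Import all_boot all_order all_algebra.
From mathcomp Require Import all_classical all_reals all_analysis.

Set Implicit Arguments.
Unset Strict Implicit.
Unset Printing Implicit Defensive.

Import Order.TTheory GRing.Theory Num.Theory.

Local Open Scope classical_set_scope.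
Local Open Scope ring_scope.

(* Sigma-algebras are passed explicitly as sets of sets, because Xi : metricType
   carries no measurableType structure; a countable set such as S or int * S is
   given its discrete sigma-algebra setT. *)

Definition borel (T : topologicalType) : set (set T) := <<s open >>.

Definition product_salgebra (T U : Type) (F : set (set T)) (G : set (set U)) :
  set (set (T * U)) := <<s [set A `*` B | A in F & B in G] >>.

Definition measurable_map (T U : Type) (F : set (set T)) (G : set (set U))
  (f : T -> U) := forall B, G B -> F (f @^-1` B).

Definition separable_space (T : topologicalType) :=
  exists2 D : set T, countable D & dense D.

(* The axiom of completeType, without the default point that completeType and
   cvg require. *)
Definition complete_space (T : uniformType) :=
  forall F : set_system T, ProperFilter F -> cauchy F -> exists l : T, F --> l.

Section random_elements.
Context (R : realType) (d : measure_display) (Omega : measurableType d).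
Variable P : probability Omega R.

Definition independent (I : eqType) (T : Type) (G : set (set T))
    (X : I -> Omega -> T) :=
  forall (s : seq I) (B : I -> set T), uniq s -> (forall i, G (B i)) ->
    P (\bigcap_(i in [set` s]) (X i @^-1` B i)) =
    (\prod_(i <- s) P (X i @^-1` B i))%E.

Definition iid (I : eqType) (T : Type) (G : set (set T)) (X : I -> Omega -> T) :=
  [/\ forall i, measurable_map measurable G (X i),
      independent G X &
      forall i j B, G B -> P (X i @^-1` B) = P (X j @^-1` B)].

Definition cond_prob (A B : set Omega) : R := fine (P (A `&` B)) / fine (P B).

End random_elements.

(* In the next two sections, Sigma : set T is the countable state space and
   matrices are indexed by Sigma: only the entries Q x y with x and y in Sigma
   are relevant. *)
Section matrices.
Context (R : realType) (T : choiceType).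
Variables (Sigma : set T) (Q : T -> T -> R).

Definition stochastic_matrix :=
  (forall x y, Sigma x -> Sigma y -> 0 <= Q x y) /\
  (forall x, Sigma x -> \esum_(y in Sigma) (Q x y)%:E = 1%E).

Fixpoint matrix_power (n : nat) (x y : T) : \bar R :=
  if n is m.+1 then (\esum_(z in Sigma) ((Q x z)%:E * matrix_power m z y))%E
  else ((x == y)%:R)%:E.

Definition irreducible_matrix :=
  forall x y, Sigma x -> Sigma y ->
    exists2 n : nat, (0 < n)%N & (0 < matrix_power n x y)%E.

(* The probability that the chain started at x first hits y at time n, where
   the starting time 0 does not count as a visit. *)
Fixpoint first_passage (n : nat) (x y : T) : \bar R :=
  match n with
  | 0 => 0%E
  | 1 => (Q x y)%:E
  | m.+1 => (\esum_(z in Sigma `\ y) ((Q x z)%:E * first_passage m z y))%E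
  end.

Definition positive_recurrent_matrix :=
  forall x, Sigma x ->
    (\sum_(0 <= n <oo) first_passage n x x = 1)%E /\
    (\sum_(0 <= n <oo) (n%:R%:E * first_passage n x x) < +oo)%E.

Definition is_gcd (A : set nat) (g : nat) :=
  (forall n, A n -> (g %| n)%N) /\
  (forall k, (forall n, A n -> (k %| n)%N) -> (k %| g)%N).

Definition aperiodic_matrix :=
  forall x, Sigma x ->
    is_gcd [set n | (0 < n)%N /\ (0 < matrix_power n x x)%E] 1.

End matrices.

Section processes.
Context (R : realType) (d : measure_display) (Omega : measurableType d).
Variable P : probability Omega R.
Context (T : choiceType).
Variable X : int -> Omega -> T.

(* Only meaningful when X is stationary, so that times 0 and 1 are typical. *)
Definition transition_matrix (x y : T) : R :=
  cond_prob P [set w | X 1 w = y] [set w | X 0 w = x].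

(* e k is the state at time t - k. *)
Definition past_event (t : int) (n : nat) (e : nat -> T) : set Omega :=
  \bigcap_(k in `I_n.+1) [set w | X (t - k%:Z) w = e k].

Definition markov_chain (Sigma : set T) (Q : T -> T -> R) :=
  [/\ countable Sigma,
      forall t, \forall w \ae P, Sigma (X t w),
      stochastic_matrix Sigma Q &
      forall (t : int) (n : nat) (e : nat -> T) (y : T),
        Sigma y -> (0 < P (past_event t n e))%E ->
        cond_prob P [set w | X (t + 1) w = y] (past_event t n e) = Q (e 0%N) y].

(* Invariance of all the finite-dimensional mass functions; these determine the
   law of X because the processes considered here are a.s. valued in a
   countable set. *)
Definition stationary :=
  forall (k : int) (s : seq (int * T)),
    P (\bigcap_(p in [set` s]) [set w | X (p.1 + k) w = p.2]) =
    P (\bigcap_(p in [set` s]) [set w | X p.1 w = p.2]).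

Definition bi_recurrent (x : T) :=
  \forall w \ae P,
    ~ has_ubound [set t | X t w = x] /\ ~ has_lbound [set t | X t w = x].

End processes.

Definition weakly_connected (V : eqType) (e : rel V) :=
  forall u v, exists2 p : seq V,
    path (fun a b => e a b || e b a) u p & last u p = v.

Section doeblin_graph.
Context (R : realType) (d : measure_display) (Omega : measurableType d).
Variable P : probability Omega R.
Context (S : countType) (Xi : topologicalType).
Variables (h : S * Xi -> S) (xi : int -> Omega -> Xi).

Definition trans_prob (x y : S) : R := fine (P [set w | h (x, xi 0 w) = y]).

Definition f_plus (w : Omega) (v : int * S) : int * S :=
  (v.1 + 1, h (v.2, xi v.1 w)).

Definition doeblin_edge (w : Omega) : rel (int * S) :=
  fun u v => v == f_plus w u.

(* The state F^v_s; only meaningful for v.1 <= s. *)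
Definition flow (w : Omega) (v : int * S) (s : int) : S :=
  (iter `|s - v.1|%N (f_plus w) v).2.

Definition as_connected := \forall w \ae P, weakly_connected (doeblin_edge w).

Definition fully_independent_transitions :=
  iid P (@borel Xi) xi /\
  forall t : int, independent P setT (fun (x : S) w => f_plus w (t, x)).

(* ereal_inf set0 = +oo: the return time is infinite if there is no return. *)
Definition return_time (x : S) (w : Omega) : \bar R :=
  ereal_inf [set (s%:~R)%:E | s in [set s : int | 0 < s /\ flow w (0, x) s = x]].

Definition positive_recurrent_state (x : S) :=
  (\int[P]_w return_time x w < +oo)%E.

Variable xstar : S.

Definition bridge_vertices (w : Omega) : set (int * S) :=
  \bigcup_(t in [set: int])
    [set (s, flow w (t, xstar) s) | s in [set s | t <= s]].

Definition bridge (t : int) (w : Omega) : set S :=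
  [set y | bridge_vertices w (t, y)].

Definition bridge_states : set (set S) :=
  [set E | (0 < P [set w | bridge 0 w = E])%E].

Definition bridge_matrix : set S -> set S -> R := transition_matrix P bridge.

End doeblin_graph.

(* Main.v *)
(* The bridge at time t is a measurable function of the driving sequence before
   time t, commuting with the time shift, and B_(t+1) = {x*} U h(B_t, xi_t).
   Stationarity and the Markov property follow. B_0 is a.s. finite by
   Borel-Cantelli: a point of B_0 lies on a path that starts at x* at some time
   -n and has not yet returned to x*, and the probabilities of no return within
   n steps sum to the mean return time.
   The event that B_t = E for arbitrarily remote past t lies in the tail of an
   i.i.d. sequence and has probability at least P(B_0 = E) > 0, hence
   probability 1 by Kolmogorov's law; stationarity transfers this to the future.
   Bi-recurrence gives irreducibility and a.s. return, and Kac's argument bounds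
   the mean return time.
   For the last part, every y in a state E of the chain leads to x* through
   transitions of positive probability. Choosing one such transition out of each
   y in E shortens all these paths simultaneously and, by independence, has
   positive probability; iterating leads from E to {x*}. *)

Require Import Defs.
From HB Require Import structures.
From mathcomp Require Import all_boot all_order all_algebra.
From mathcomp Require Import all_classical all_reals all_analysis.
From mathcomp Require Import measurable_realfun.

Set Implicit Arguments.
Unset Strict Implicit.
Unset Printing Implicit Defensive.

Import Order.TTheory GRing.Theory Num.Theory.

Local Open Scope classical_set_scope.
Local Open Scope ring_scope.

(** * Independence of generated sigma-algebras *)

Lemma dynkin_g_sigma_algebra (T : Type) (G H : set (set T)) :
  setI_closed G -> dynkin H -> G `<=` H -> <<s G >> `<=` H.
Proof.
move=> GI dH GH A; rewrite -(setI_closed_g_dynkin_g_sigma_algebra GI).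
by apply; split.
Qed.

(** The probability lives on [Omega] but the generating classes consist of sets of values, so the
    pi-lambda argument has to run on preimages. *)
Lemma dynkin_preimage (T U : Type) (f : T -> U) (H : set (set T)) :
  dynkin H -> dynkin [set A | H (f @^-1` A)].
Proof.
move=> [HT HC HU]; split => [|A /= /HC|F tF HF] /=; first by rewrite preimage_setT.
  by rewrite -preimage_setC.
rewrite preimage_bigcup; apply: HU => // i j _ _ [w [Fi Fj]].
by apply: (tF i j) => //; exists (f w).
Qed.

Lemma preimage_g_sigma_algebra (T U : Type) (f : T -> U)
    (F : set (set T)) (G : set (set U)) :
  (forall A, G A -> <<s F >> (f @^-1` A)) ->
  forall A, <<s G >> A -> <<s F >> (f @^-1` A).
Proof.
have [F0 FC FU] := @smallest_sigma_algebra _ setT F.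
move=> GF; apply: smallest_sub => //; split => [|B FB|B FB] /=.
- by rewrite preimage_set0.
- by rewrite setTD -preimage_setC -setTD; exact: FC.
- by rewrite preimage_bigcup; exact: FU.
Qed.

Section dynkin_probability.
Context (R : realType) (d : measure_display) (Omega : measurableType d).
Variable P : probability Omega R.

Let EFP A : measurable A -> P A = (fine (P A))%:E.
Proof. by move=> mA; rewrite fineK// fin_num_measure. Qed.

(** Complements use P(B) = P(A & B) + P(~A & B). Measurability is carried inside the class because
    additivity of [P] holds only on measurable sets. *)
Lemma dynkin_indep (B : set Omega) : measurable B ->
  dynkin [set A | measurable A /\ P (A `&` B) = (P A * P B)%E].
Proof.
move=> mB; split => [|A [mA AB]|F tF HF] /=.
- by rewrite setTI probability_setT mul1e.
- split; first exact: measurableC.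
  have mCB := measurableI _ _ (measurableC mA) mB.
  have : P B = (P (A `&` B) + P (~` A `&` B))%E.
    rewrite -measureU//; first by rewrite -setIUl setUv setTI.
      exact: measurableI.
    by rewrite setIACA setICr set0I.
  rewrite AB probability_setC// (EFP mA) (EFP mB) (EFP mCB) -EFinB -!EFinM -EFinD => -[e].
  by congr EFin; rewrite mulrBl mul1r {1}e addrC addKr.
- have mF n : measurable (F n) by case: (HF n).
  split; first exact: bigcup_measurable.
  rewrite setI_bigcupl !measure_semi_bigcup//.
  + rewrite muleC (EFP mB) -nneseriesZl// -(EFP mB).
    by apply: eq_eseriesr => n _; rewrite muleC; exact: (HF n).2.
  + exact: bigcup_measurable.
  + by move=> n; exact: measurableI.
  + by move=> i j _ _ [w [[Fi _] [Fj _]]]; apply: (tF i j) => //; exists w.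
  + by apply: bigcup_measurable => n _; exact: measurableI.
Qed.

Lemma dynkin_eq_law (U : Type) (f g : Omega -> U) :
  dynkin [set A | [/\ measurable (f @^-1` A), measurable (g @^-1` A) &
                      P (f @^-1` A) = P (g @^-1` A)]].
Proof.
split => [|A [fA gA e]|F tF HF] /=.
- by rewrite !preimage_setT.
- rewrite -!preimage_setC; split; [exact: measurableC..|].
  by rewrite !probability_setC// e.
- have tp k : trivIset setT (fun n => k @^-1` F n).
    by move=> i j _ _ [w [Fi Fj]]; apply: (tF i j) => //; exists (k w).
  rewrite !preimage_bigcup; split; try by apply: bigcup_measurable => n _; case: (HF n).
  rewrite !measure_semi_bigcup//.
  + by apply: eq_eseriesr => n _; case: (HF n).
  + by move=> n; case: (HF n).
  + by apply: bigcup_measurable => n _; case: (HF n).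
  + by move=> n; case: (HF n).
  + by apply: bigcup_measurable => n _; case: (HF n).
Qed.

(** The pi-lambda argument is applied twice: first to [F] against a fixed generator in [G], then to
    [G] against a fixed member of the sigma-algebra generated by [F]. *)
Lemma indep_g_sigma_algebra (U : Type) (f : Omega -> U) (F G : set (set U)) :
  setI_closed F -> setI_closed G ->
  (forall A, F A -> measurable (f @^-1` A)) ->
  (forall A, G A -> measurable (f @^-1` A)) ->
  (forall A B, F A -> G B ->
     P (f @^-1` A `&` f @^-1` B) = (P (f @^-1` A) * P (f @^-1` B))%E) ->
  forall A B, <<s F >> A -> <<s G >> B ->
     P (f @^-1` A `&` f @^-1` B) = (P (f @^-1` A) * P (f @^-1` B))%E.
Proof.
move=> FI GI mF mG FG.
have step1 B : G B -> forall A, <<s F >> A -> measurable (f @^-1` A) /\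
    P (f @^-1` A `&` f @^-1` B) = (P (f @^-1` A) * P (f @^-1` B))%E.
  move=> GB; apply: (dynkin_g_sigma_algebra FI).
    exact: (dynkin_preimage f (dynkin_indep (mG _ GB))).
  by move=> A FA; split; [exact: mF | exact: FG].
move=> A B FA GB.
(* [step1] yields this only when [G] has a member, so it is proved separately. *)
have mA : measurable (f @^-1` A).
  apply: (dynkin_g_sigma_algebra FI _ _ FA (H := [set A | measurable (f @^-1` A)])) => //.
  apply: (@dynkin_preimage _ _ f measurable); split => //.
  - exact: measurableC.
  - by move=> E _ mE; exact: bigcup_measurable.
suff [] : measurable (f @^-1` B) /\
    P (f @^-1` B `&` f @^-1` A) = (P (f @^-1` B) * P (f @^-1` A))%E.
  by move=> _; rewrite setIC muleC.
move: B GB; apply: (dynkin_g_sigma_algebra GI).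
  exact: (dynkin_preimage f (dynkin_indep mA)).
by move=> B GB; split; [exact: mG | rewrite setIC muleC; exact: (step1 _ GB _ FA).2].
Qed.

End dynkin_probability.

(** * Closure properties of sigma-algebras given as sets of sets *)

Section salgebra_closure.
Context (U : Type) (F : set (set U)).
Hypothesis F_salgebra : sigma_algebra setT F.

Lemma salgebraC A : F A -> F (~` A).
Proof. by case: F_salgebra => _ FC _ /FC; rewrite setTD. Qed.

Lemma salgebraT : F setT.
Proof. by rewrite -setC0; apply: salgebraC; case: F_salgebra. Qed.

Lemma salgebra_bigcup (I : countType) (D : set I) (A : I -> set U) :
  (forall i, D i -> F (A i)) -> F (\bigcup_(i in D) A i).
Proof.
case: F_salgebra => F0 _ FU FA; pose A' n := if unpickle n is Some i then
  (if pselect (D i) is left _ then A i else set0) else set0.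
have -> : \bigcup_(i in D) A i = \bigcup_n A' n.
  apply/seteqP; split => u.
    move=> [i Di Ai]; exists (pickle i) => //; rewrite /A' pickleK.
    by case: pselect.
  move=> [n _]; rewrite /A'; case: unpickle => // i.
  by case: pselect => // Di Ai; exists i.
apply: FU => n; rewrite /A'; case: unpickle => // i.
by case: pselect => // /FA.
Qed.

Lemma salgebra_bigcap (I : countType) (D : set I) (A : I -> set U) :
  (forall i, D i -> F (A i)) -> F (\bigcap_(i in D) A i).
Proof.
move=> FA; rewrite -[X in F X]setCK setC_bigcap; apply: salgebraC.
by apply: salgebra_bigcup => i /FA; exact: salgebraC.
Qed.

Lemma salgebraI A B : F A -> F B -> F (A `&` B).
Proof.
move=> FA FB; have -> : A `&` B = \bigcap_(b : bool) (if b then A else B).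
  apply/seteqP; split => u; first by move=> [Au Bu] [].
  by move=> AB; split; [exact: (AB true) | exact: (AB false)].
by apply: salgebra_bigcap => -[].
Qed.

(** A random subset of a countable set is determined by countably many membership events. Hence each
    event [f u = E] is available, although [set S] may be uncountable. *)
Lemma salgebra_set_eq (S : countType) (f : U -> set S) (E : set S) :
  (forall y, F [set u | f u y]) -> F [set u | f u = E].
Proof.
move=> Ff.
rewrite (_ : [set u | f u = E] =
    (\bigcap_(y in E) [set u | f u y]) `&` \bigcap_(y in ~` E) ~` [set u | f u y]).
  by apply: salgebraI; apply: salgebra_bigcap => y _ //; exact: salgebraC.
apply/seteqP; split => [u /= <-|u [uE uCE] /=]; first by split.
apply/seteqP; split => y; last exact: uE.
by move=> uy; apply: contrapT => /uCE.
Qed.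

End salgebra_closure.

(** * Trajectories of an i.i.d. sequence *)

Section coordinates.
Context (Xi : Type).
Variable G : set (set Xi).

(** The condition [uniq s] lets the product formula in [independent] apply directly to a
    cylinder. *)
Definition cylinder (I : set int) : set (set (int -> Xi)) :=
  [set C | exists (s : seq int) (A : int -> set Xi),
     [/\ uniq s, [set` s] `<=` I, forall i, G (A i) &
         C = [set u | forall i, i \in s -> A i (u i)]]].

Definition coords (I : set int) : set (set (int -> Xi)) := <<s cylinder I >>.

Definition time_shift (k : int) (u : int -> Xi) : int -> Xi := fun t => u (t + k).

Lemma time_shift0 u : time_shift 0 u = u.
Proof. by apply/funext => t; rewrite /time_shift addr0. Qed.

Lemma time_shiftD k l u : time_shift k (time_shift l u) = time_shift (k + l) u.
Proof. by apply/funext => t; rewrite /time_shift addrA. Qed.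

Lemma coords_sub (I J : set int) : I `<=` J -> coords I `<=` coords J.
Proof.
move=> IJ; apply: sub_smallest2r; first exact: smallest_sigma_algebra.
move=> _ [s [A [us sI GA ->]]].
by exists s, A; split => //; exact: subset_trans sI IJ.
Qed.

Lemma coords_salgebra I : sigma_algebra setT (coords I).
Proof. exact: smallest_sigma_algebra. Qed.

Lemma coordsC I A : coords I A -> coords I (~` A).
Proof. by apply: salgebraC; exact: coords_salgebra. Qed.

Lemma coordsT I : coords I setT.
Proof. by apply: salgebraT; exact: coords_salgebra. Qed.

Lemma coordsI I A B : coords I A -> coords I B -> coords I (A `&` B).
Proof. by apply: salgebraI; exact: coords_salgebra. Qed.

Lemma coords_bigcup I (T : countType) (D : set T) (F : T -> set (int -> Xi)) :
  (forall i, D i -> coords I (F i)) -> coords I (\bigcup_(i in D) F i).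
Proof. by apply: salgebra_bigcup; exact: coords_salgebra. Qed.

Lemma coords_bigcap I (T : countType) (D : set T) (F : T -> set (int -> Xi)) :
  (forall i, D i -> coords I (F i)) -> coords I (\bigcap_(i in D) F i).
Proof. by apply: salgebra_bigcap; exact: coords_salgebra. Qed.

Hypothesis G_sigma : sigma_algebra setT G.

Lemma cylinder_setI I : setI_closed (cylinder I).
Proof.
move=> _ _ [s [A [us sI GA ->]]] [s' [A' [us' sI' GA' ->]]].
(* A time listed in only one of [s] and [s'] gets [setT] from the other cylinder. *)
exists (undup (s ++ s')), (fun i => (if i \in s then A i else setT) `&`
                                    (if i \in s' then A' i else setT)).
split.
- exact: undup_uniq.
- by move=> i /=; rewrite mem_undup mem_cat => /orP[/sI|/sI'].
- move=> i; apply: (salgebraI G_sigma); case: ifP => // _; exact: salgebraT.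
- apply/seteqP; split => u /=.
    by move=> [sA sA'] i _; split; case: ifP => // ?; [exact: sA | exact: sA'].
  move=> uAA'; split=> i si; have := uAA' i; rewrite mem_undup mem_cat si ?orbT => /(_ isT)[];
  by rewrite ?si.
Qed.

Lemma coords_coord (I : set int) i A : I i -> G A -> coords I [set u | A (u i)].
Proof.
move=> Ii GA; apply: sub_sigma_algebra; exists [:: i], (fun=> A); split => //.
- by move=> j /=; rewrite inE => /eqP ->.
- apply/seteqP; split => u /=; first by move=> Au j; rewrite inE => /eqP ->.
  by apply; rewrite inE.
Qed.

(** [time_shift k u] reads [u] at i + k, so a constraint at time i becomes one at i + k. *)
Lemma cylinder_shift k I A :
  cylinder I A -> cylinder [set i | I (i - k)] (time_shift k @^-1` A).
Proof.
move=> [s [B [us sI GB ->]]].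
exists (map (+%R^~ k) s), (fun j => B (j - k)); split => //.
- by rewrite map_inj_uniq//; exact: addIr.
- by move=> _ /= /mapP[i si ->]; rewrite addrK; exact: sI.
- apply/seteqP; split => u /=.
    by move=> uB _ /mapP[i si ->]; rewrite addrK; exact: uB.
  by move=> uB i si; rewrite -{1}(addrK k i); apply: uB; exact: map_f.
Qed.

Lemma coords_shift k I A :
  coords I A -> coords [set i | I (i - k)] (time_shift k @^-1` A).
Proof.
move=> cA; apply: (preimage_g_sigma_algebra _ cA) => C /(cylinder_shift k).
exact: sub_sigma_algebra.
Qed.

End coordinates.
Arguments coords_shift {Xi G} k {I A}.

(** * The law of an i.i.d. trajectory: independence, stationarity, zero-one law *)

Section iid_law.
Context (R : realType) (d : measure_display) (Omega : measurableType d).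
Variable P : probability Omega R.
Context (Xi : Type) (G : set (set Xi)).
Hypothesis G_sigma : sigma_algebra setT G.
Variable xi : int -> Omega -> Xi.
Hypothesis xi_iid : iid P G xi.

Definition trajectory (w : Omega) : int -> Xi := fun t => xi t w.

Lemma trajectory_cylinder (s : seq int) (A : int -> set Xi) :
  trajectory @^-1` [set u | forall i, i \in s -> A i (u i)] =
  \bigcap_(i in [set` s]) (xi i @^-1` A i).
Proof. by apply/seteqP; split. Qed.

Lemma measurable_trajectory_cylinder I A :
  cylinder G I A -> measurable (trajectory @^-1` A).
Proof.
move=> [s [B [us sI GB ->]]]; rewrite trajectory_cylinder.
have [mxi _ _] := xi_iid.
by apply: fin_bigcap_measurable => [|i _]; [exact: finite_seq | exact/mxi/GB].
Qed.

Lemma measurable_trajectory I A : coords G I A -> measurable (trajectory @^-1` A).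
Proof.
move=> cA; apply: (dynkin_g_sigma_algebra (@cylinder_setI _ _ G_sigma I) _ _ cA
         (H := [set A | measurable (trajectory @^-1` A)])).
  apply: (@dynkin_preimage _ _ trajectory measurable); split => //.
  - exact: measurableC.
  - by move=> E _ mE; exact: bigcup_measurable.
by move=> B; exact: measurable_trajectory_cylinder.
Qed.

Lemma prob_cylinder (s : seq int) (A : int -> set Xi) : uniq s -> (forall i, G (A i)) ->
  P (trajectory @^-1` [set u | forall i, i \in s -> A i (u i)]) =
  (\prod_(i <- s) P (xi i @^-1` A i))%E.
Proof.
have [_ indep _] := xi_iid.
by move=> us GA; rewrite trajectory_cylinder indep.
Qed.

(** For cylinders, disjointness of [I] and [J] makes the concatenated list of times duplicate-free,
    so the joint probability is one product that splits in two. [indep_g_sigma_algebra] does the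
    rest. *)
Lemma indep_coords I J A B : I `&` J = set0 -> coords G I A -> coords G J B ->
  P (trajectory @^-1` A `&` trajectory @^-1` B) =
  (P (trajectory @^-1` A) * P (trajectory @^-1` B))%E.
Proof.
move=> IJ; rewrite /coords; apply: indep_g_sigma_algebra; try exact: cylinder_setI.
- by move=> ?; exact: measurable_trajectory_cylinder.
- by move=> ?; exact: measurable_trajectory_cylinder.
move=> _ _ [s [E [us sI GE ->]]] [s' [E' [us' sI' GE' ->]]].
pose E2 i := if i \in s then E i else E' i.
have ss' i : i \in s -> i \in s' -> False.
  by move=> /sI Ii /sI' Ji; have : (I `&` J) i by []; rewrite IJ.
rewrite -preimage_setI (_ : _ `&` _ =
    [set u | forall i, i \in s ++ s' -> E2 i (u i)]); last first.
  apply/seteqP; split => u /=.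
    move=> [uE uE'] i; rewrite mem_cat /E2; case: ifPn => [si _|_ /=]; first exact: uE.
    exact: uE'.
  move=> uE; split => i si; have := uE i; rewrite mem_cat /E2 si ?orbT.
    exact.
  by case: ifPn => [/ss'/(_ si)//|_]; exact.
rewrite !prob_cylinder//; last first.
- by move=> i; rewrite /E2; case: ifP.
- rewrite cat_uniq us us' andbT/=; apply/hasPn => i si'.
  by apply/negP => si; exact: (ss' i).
rewrite big_cat/=; congr (_ * _)%E; apply: eq_big_seq => i si; rewrite /E2.
  by rewrite si.
by case: ifPn => // /ss'/(_ si).
Qed.

(** On cylinders both sides are products of one-time probabilities, equal factor by factor by
    identical distribution; the sets on which two laws agree form a Dynkin class. *)
Lemma trajectory_stationary k A : coords G setT A ->
  P (trajectory @^-1` (time_shift k @^-1` A)) = P (trajectory @^-1` A).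
Proof.
move=> cA; pose f := time_shift k \o trajectory.
suff [] : [/\ measurable (f @^-1` A), measurable (trajectory @^-1` A) &
              P (f @^-1` A) = P (trajectory @^-1` A)] by [].
apply: (dynkin_g_sigma_algebra (@cylinder_setI _ _ G_sigma setT)
  (dynkin_eq_law P f trajectory) _ cA) => {cA}A cA; split.
- exact: (measurable_trajectory_cylinder (cylinder_shift k cA)).
- exact: measurable_trajectory_cylinder cA.
case: cA => [s [B [us _ GB ->]]].
rewrite [RHS]prob_cylinder// /f.
have -> : (time_shift k \o trajectory) @^-1` [set u | forall i, i \in s -> B i (u i)] =
  trajectory @^-1` [set u | forall i, i \in map (+%R^~ k) s -> B (i - k) (u i)].
  apply/seteqP; split => u /=.
    by move=> uB _ /mapP[i si ->]; rewrite addrK; exact: uB.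
  by move=> uB i si; rewrite -{1}(addrK k i); apply: uB; exact: map_f.
rewrite (@prob_cylinder _ (fun i => B (i - k)))//; last first.
  by rewrite map_inj_uniq//; exact: addIr.
rewrite big_map; apply: eq_big_seq => i si; rewrite addrK.
by have [_ _] := xi_iid; exact.
Qed.

(* Kolmogorov's zero-one law for the remote past: such an event is independent
   of every cylinder, hence of itself. *)
Lemma zero_one_past A : (forall t : int, coords G [set i | i < t] A) ->
  P (trajectory @^-1` A) = 0%E \/ P (trajectory @^-1` A) = 1%E.
Proof.
move=> pA.
have cA : coords G setT A by exact: coords_sub (pA 0).
have mA := measurable_trajectory cA.
have indepA B : coords G setT B -> P (trajectory @^-1` A `&` trajectory @^-1` B) =
    (P (trajectory @^-1` A) * P (trajectory @^-1` B))%E.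
  apply: (@indep_g_sigma_algebra _ _ _ P _ trajectory [set A] (cylinder G setT));
    last exact: sub_sigma_algebra.
  - by move=> _ _ -> ->; rewrite setIid.
  - exact: cylinder_setI.
  - by move=> _ ->.
  - exact: measurable_trajectory_cylinder.
  move=> _ C -> [s [E [us _ GE ->]]].
  (* A cylinder constrains finitely many times; the remote event lives strictly before all of
     them. *)
  have [t ts] : exists t : int, forall i, i \in s -> t <= i.
    elim: s {us} => [|i s [t ts]]; first by exists 0.
    exists (Num.min i t) => j; rewrite inE ge_min => /orP[/eqP ->|/ts ->].
      by rewrite lexx.
    by rewrite orbT.
  apply: (@indep_coords [set i | i < t] [set i | t <= i]) => //.
    by apply/seteqP; split => // i [/= /lt_geF ->].
  apply: sub_sigma_algebra; exists s, E; split => //.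
have := indepA _ cA; rewrite setIid.
rewrite -(fineK (fin_num_measure P _ mA)) -EFinM => -[].
have [/eqP -> _|nz e] := boolP (fine (P (trajectory @^-1` A)) == 0); first by left.
by right; congr EFin; apply: (mulIf nz); rewrite mul1r -e.
Qed.

End iid_law.
Arguments trajectory_stationary {R d Omega P Xi G} G_sigma {xi} xi_iid k {A}.

(** * Sums over countable index sets *)

Section countable_sums.
Local Open Scope ereal_scope.

(** One inequality follows from finite partial sums. For c > 0 the other is the same inequality
    applied to the factor 1/c; the case c = 0 is separate. *)
Lemma esumZl (R : realType) (T : choiceType) (D : set T) (c : R) (a : T -> \bar R) :
  (0 <= c)%R -> (forall i, 0 <= a i) ->
  \esum_(i in D) (c%:E * a i) = c%:E * \esum_(i in D) a i.
Proof.
have le (k : R) (b : T -> \bar R) : (0 <= k)%R -> (forall i, 0 <= b i) ->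
    \esum_(i in D) (k%:E * b i) <= k%:E * \esum_(i in D) b i.
  move=> k0 b0; apply: ge_ereal_sup => _ [X DX <-].
  rewrite -ge0_mule_fsumr//; rewrite lee_wpmul2l ?lee_fin//.
  by apply: esum_ge; exists X.
move=> c0 a0; apply/eqP; rewrite eq_le le//=.
move: c0; rewrite le0r => /orP[/eqP ->|c0].
  by rewrite mul0e; apply: esum_ge0 => i _; rewrite mul0e.
have ca0 i : 0 <= c%:E * a i by rewrite mule_ge0// lee_fin ltW.
rewrite -lee_pdivlMl//; apply: (le_trans _ (le _ _ _ ca0)); last first.
  by rewrite invr_ge0 ltW.
apply: le_esum => i _.
by rewrite muleA -EFinM mulVf ?mul1e// gt_eqF.
Qed.

Lemma measure_bigcup_countable (R : realType) (d : measure_display)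
    (Omega : measurableType d) (mu : {measure set Omega -> \bar R})
    (T : choiceType) (D : set T) (F : T -> set Omega) :
  countable D -> trivIset D F -> (forall i, D i -> measurable (F i)) ->
  measurable (\bigcup_(i in D) F i) /\
  mu (\bigcup_(i in D) F i) = \esum_(i in D) mu (F i).
Proof.
move=> /countable_bijP[N /card_set_bijP[e eDN]] tF mF.
have [eD einj esurj] := eDN.
(* A union over the fibre of [e] transports the family to natural numbers without choosing an
   inverse of [e]. *)
pose F' n := \bigcup_(i in [set i | D i /\ e i = n]) F i.
have F'e i : D i -> F' (e i) = F i.
  move=> Di; apply/seteqP; split => [w [j /= [Dj eji]]|w Fi]; last by exists i.
  by rewrite (einj _ _ (mem_set Dj) (mem_set Di) eji).
have F'U : \bigcup_(i in D) F i = \bigcup_(n in N) F' n.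
  apply/seteqP; split => [w [i Di Fi]|w [n Nn [i [Di _] Fi]]]; last by exists i.
  by exists (e i); [exact: eD | rewrite F'e].
have mF' n : N n -> measurable (F' n).
  by move=> /esurj[i Di <-]; rewrite F'e//; exact: mF.
have tF' : trivIset N F'.
  move=> _ _ /esurj[i Di <-] /esurj[j Dj <-]; rewrite !F'e// => /tF.
  by move=> /(_ Di Dj) ->.
rewrite F'U; split; first exact: bigcup_measurable.
rewrite measure_bigcup// nneseries_esum//.
rewrite set_mem_set.
rewrite (reindex_esum _ _ _ _ eDN); apply: eq_esum => i Di.
by rewrite F'e.
Qed.

End countable_sums.

Lemma mule_pI (R : realType) (c a b : \bar R) :
  c \is a fin_num -> (0 < c)%E -> (c * a = c * b)%E -> a = b.
Proof.
move=> cf c0 cab; apply/eqP; rewrite eq_le.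
by apply/andP; split; rewrite -(lee_pmul2l cf c0) cab.
Qed.

(** * Almost sure comparison, and monotone limits of equally likely events *)

Section almost_sure.
Context (R : realType) (d : measure_display) (Omega : measurableType d).
Variable P : probability Omega R.
Local Open Scope ereal_scope.

Lemma ae_le_measure (A B : set Omega) : measurable A -> measurable B ->
  (\forall w \ae P, A w -> B w) -> P A <= P B.
Proof.
move=> mA mB [N [mN N0 sN]].
apply: (@le_trans _ _ (P (B `|` N))).
  rewrite le_measure ?inE//; first exact: measurableU.
  move=> w Aw; have [Bw|nBw] := pselect (B w); [by left | right].
  by apply: sN => /(_ Aw).
by rewrite (le_trans (measureU2 _ _ _))// [X in _ + X]N0 adde0.
Qed.

Lemma ae_eq_measure (A B : set Omega) : measurable A -> measurable B ->
  (\forall w \ae P, A w <-> B w) -> P A = P B.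
Proof.
move=> mA mB [N [mN N0 sN]]; apply/eqP; rewrite eq_le; apply/andP; split;
  apply: ae_le_measure => //; exists N; split => // w /= nAB; apply: sN => /= AB;
  by apply: nAB => /AB.
Qed.

Lemma ae_prob1 (A : set Omega) : measurable A -> P A = 1 -> \forall w \ae P, A w.
Proof.
move=> mA A1; exists (~` A); split => //; first exact: measurableC.
by rewrite probability_setC// A1 subee.
Qed.

(** Meant for time-shifted hitting events: stationarity makes their probabilities equal, so
    continuity of the measure loses nothing in the limit. *)
Lemma nonincreasing_cst_prob (F : nat -> set Omega) c :
  (forall n, measurable (F n)) -> (forall n, F n.+1 `<=` F n) ->
  (forall n, P (F n) = c) -> P (\bigcap_n F n) = c.
Proof.
move=> mF dF Fc.
have cF : (P \o F) x @[x --> \oo] --> P (\bigcap_n F n).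
  apply: nonincreasing_cvg_mu => //.
  - by rewrite ltey_eq fin_num_measure.
  - exact: bigcapT_measurable.
  - by apply/nonincreasing_seqP => n; rewrite subsetEset; exact: dF.
apply: (cvg_unique _ cF) => //.
rewrite (_ : P \o F = fun=> c); first exact: cvg_cst.
by apply/funext => n /=.
Qed.

Lemma nondecreasing_cst_prob (F : nat -> set Omega) c :
  (forall n, measurable (F n)) -> (forall n, F n `<=` F n.+1) ->
  (forall n, P (F n) = c) -> P (\bigcup_n F n) = c.
Proof.
move=> mF dF Fc.
have cF : (P \o F) x @[x --> \oo] --> P (\bigcup_n F n).
  apply: nondecreasing_cvg_mu => //.
  - exact: bigcup_measurable.
  - by apply/nondecreasing_seqP => n; rewrite subsetEset; exact: dF.
apply: (cvg_unique _ cF) => //.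
rewrite (_ : P \o F = fun=> c); first exact: cvg_cst.
by apply/funext => n /=.
Qed.

End almost_sure.

(** * Markov chains that are factors of an i.i.d. sequence *)

Section factor_chain.
Context (R : realType) (d : measure_display) (Omega : measurableType d).
Variable P : probability Omega R.
Context (Xi : Type) (G : set (set Xi)).
Hypothesis G_sigma : sigma_algebra setT G.
Variable xi : int -> Omega -> Xi.
Hypothesis xi_iid : iid P G xi.
Context (T : choiceType) (beta : (int -> Xi) -> T) (Phi : T -> Xi -> T).
Hypothesis beta_past : forall x, coords G [set i | i < 0] [set u | beta u = x].
Hypothesis Phi_meas : forall x y, G [set v | Phi x v = y].
Hypothesis beta_step : forall u, beta (time_shift 1 u) = Phi (beta u) (u 0).

(** Since [beta] reads strictly negative times only, the value at time t is a function of the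
    driving sequence before t and is independent of [xi t]. This is the source of the Markov
    property. *)
Definition factor_process (t : int) (w : Omega) : T := beta (time_shift t (trajectory xi w)).

Definition factor_states : set T := [set x | (0 < P [set w | factor_process 0 w = x])%E].

Variable D : set T.
Hypothesis D_countable : countable D.
Hypothesis factor_D : \forall w \ae P, D (factor_process 0 w).

Local Notation Y := factor_process.
Local Notation Sigma := factor_states.
Local Notation Q := (transition_matrix P factor_process).

(** The natural filtration of [xi], indexed so that [past t] excludes [xi t]. *)
Definition past (t : int) (A : set Omega) :=
  exists2 C, coords G [set i | i < t] C & A = trajectory xi @^-1` C.

Lemma past_sub s t : s <= t -> past s `<=` past t.
Proof.
move=> st _ [C cC ->]; exists C => //; apply: coords_sub cC => i /= lis.
exact: lt_le_trans st.
Qed.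

Lemma measurable_past t A : past t A -> measurable A.
Proof. by move=> [C cC ->]; exact: (measurable_trajectory G_sigma xi_iid cC). Qed.

Lemma pastI t A B : past t A -> past t B -> past t (A `&` B).
Proof.
move=> [C cC ->] [C' cC' ->]; exists (C `&` C') => //; exact: coordsI.
Qed.

Lemma pastC t A : past t A -> past t (~` A).
Proof. by move=> [C cC ->]; exists (~` C) => //; exact: coordsC. Qed.

Lemma past_bigcap t (I : countType) (E : set I) (F : I -> set Omega) :
  (forall i, E i -> past t (F i)) -> past t (\bigcap_(i in E) F i).
Proof.
move=> pF.
have /choice[C HC] : forall i, exists C, E i ->
    coords G [set i | i < t] C /\ F i = trajectory xi @^-1` C.
  move=> i; have [/pF[C ? ?]|] := pselect (E i); first by exists C.
  by exists set0.
exists (\bigcap_(i in E) C i).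
  by apply: coords_bigcap => i /HC[].
apply/seteqP; split => w Fw i Ei; have := Fw i Ei; by rewrite (HC i Ei).2.
Qed.

Lemma past_factor s t x : s <= t -> past t [set w | Y s w = x].
Proof.
move=> st; exists (time_shift s @^-1` [set u | beta u = x]); last by [].
apply: (coords_sub _ (coords_shift s (beta_past x))) => i /=.
by rewrite subr_lt0 => /lt_le_trans; apply.
Qed.

Lemma measurable_factor t x : measurable [set w | Y t w = x].
Proof. exact: measurable_past (past_factor x (lexx t)). Qed.

Lemma factor_stationary k A : coords G setT A ->
  P [set w | A (time_shift k (trajectory xi w))] = P [set w | A (trajectory xi w)].
Proof. exact: trajectory_stationary. Qed.

Lemma factorD s t w :
  Y (s + t) w = beta (time_shift s (time_shift t (trajectory xi w))).
Proof. by rewrite time_shiftD. Qed.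

Lemma coords_factor t x :
  coords G setT [set u | beta (time_shift t u) = x].
Proof.
exact: (coords_sub (@subsetT _ _) (coords_shift t (beta_past x))).
Qed.

Lemma prob_factor t x : P [set w | Y t w = x] = P [set w | Y 0 w = x].
Proof.
rewrite /factor_process (factor_stationary t (coords_sub (@subsetT _ _) (beta_past x))).
by congr (P _); apply/seteqP; split => w /=; rewrite time_shift0.
Qed.

Lemma factor_is_stationary : stationary P Y.
Proof.
move=> k s.
rewrite (_ : \bigcap_(p in [set` s]) [set w | Y (p.1 + k) w = p.2] =
  [set w | (\bigcap_(p in [set` s]) [set u | beta (time_shift p.1 u) = p.2])
            (time_shift k (trajectory xi w))]); last first.
  apply/seteqP; split => w /= sw p sp; have := sw p sp.
    by rewrite /= factorD.
  by rewrite /= factorD.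
rewrite factor_stationary// bigcap_seq; apply: (big_ind (coords G setT)).
- exact: coordsT.
- by move=> A B; exact: coordsI.
- by move=> p _; exact: coords_factor.
Qed.

(** The kernel read off the law of [xi 0]. The conditional probability in [transition_matrix] is
    identified with it at states of positive mass; elsewhere that quotient is 0 by the convention on
    division by zero. *)
Definition step_prob (x y : T) : \bar R := P [set w | Phi x (xi 0 w) = y].

(** On [A] the next state is [Phi x (xi t)], which depends on time t alone, whereas [A] depends on
    earlier times. *)
Lemma markov_step t A x y : past t A -> A `<=` [set w | Y t w = x] ->
  P (A `&` [set w | Y (t + 1) w = y]) = (P A * step_prob x y)%E.
Proof.
move=> [C cC ->] Ax.
rewrite (_ : _ `&` _ = trajectory xi @^-1` C `&`
    trajectory xi @^-1` [set u | Phi x (u t) = y]); last first.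
  by apply/seteqP; split => w /= -[Cw]; rewrite addrC factorD beta_step
    -[beta _]/(Y t w) (Ax w Cw) /time_shift/= add0r.
have cPhi s : coords G [set s] [set u | Phi x (u s) = y].
  exact: (coords_coord (i := s) (A := [set v | Phi x v = y])).
rewrite (@indep_coords _ _ _ _ _ _ G_sigma _ xi_iid [set i | i < t] [set t])//; last first.
  by apply/seteqP; split => // i [/=] /[swap] ->; rewrite ltxx.
congr (_ * _)%E; rewrite /step_prob.
rewrite -(factor_stationary t (coords_sub (@subsetT _ _) (cPhi 0))).
by congr (P _); apply/seteqP; split => w /=; rewrite /time_shift add0r.
Qed.

Lemma sum_factor t A (E : set T) : countable E -> measurable A ->
  measurable (A `&` [set w | E (Y t w)]) /\
  P (A `&` [set w | E (Y t w)]) = \esum_(x in E) P (A `&` [set w | Y t w = x]).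
Proof.
move=> cE mA; rewrite (_ : A `&` _ = \bigcup_(x in E) (A `&` [set w | Y t w = x])).
  apply: measure_bigcup_countable => //.
    by move=> x y _ _ [w [[_ /= <-] [_ /= <-]]].
  by move=> x _; apply: measurableI => //; exact: measurable_factor.
apply/seteqP; split => [w [Aw Ew]|w [x Ex [Aw /= Yx]]]; first by exists (Y t w).
by split => //=; rewrite Yx.
Qed.

Lemma factor_states_sub : Sigma `<=` D.
Proof.
move=> x; apply: contraPP => nDx; apply/negP; rewrite -leNgt measure_le0; apply/eqP.
apply: measure_negligible; first exact: measurable_factor.
by apply: negligibleS factor_D => w /= ->.
Qed.

Lemma factor_states_countable : countable Sigma.
Proof. exact: sub_countable (subset_card_le factor_states_sub) D_countable. Qed.

(** [T] may be uncountable, so the countable carrier [D] is what makes this work: [D] minus [Sigma]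
    is a countable set of null states. Stationarity then passes from time 0 to t. *)
Lemma factor_in_states t : \forall w \ae P, Sigma (Y t w).
Proof.
have prob s (E : set T) : countable E -> measurable [set w | E (Y s w)] /\
    P [set w | E (Y s w)] = \esum_(x in E) P [set w | Y 0 w = x].
  move=> cE; have := sum_factor s cE (@measurableT _ Omega).
  rewrite setTI => -[mE ->]; split => //.
  by apply: eq_esum => x _; rewrite setTI prob_factor.
have [mS PS] := prob t _ factor_states_countable.
apply: ae_prob1 => //; rewrite PS.
have [mS0 <-] := prob 0 _ factor_states_countable.
apply/eqP; rewrite eq_le probability_le1//=.
have cDS : countable (D `\` Sigma).
  exact: sub_countable (subset_card_le (@subDsetl _ _ _)) D_countable.
have [mDS PDS] := prob 0 _ cDS.
have DS0 : P [set w | (D `\` Sigma) (Y 0 w)] = 0%E.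
  rewrite PDS esum1// => x [_ /negP]; rewrite -leNgt measure_le0 => /eqP //.
rewrite -(@probability_setT _ _ _ P); apply: ae_le_measure => //.
have : P.-negligible ([set w | (D `\` Sigma) (Y 0 w)] `|` ~` [set w | D (Y 0 w)]).
  by apply: negligibleU => //; apply/negligibleP.
apply: negligibleS => w /= /not_implyP[_ nS].
by have [Dw|nDw] := pselect (D (Y 0 w)); [left | right].
Qed.

(** Law of total probability. The sum runs over [Sigma] because the rest of [E], possibly
    uncountable, is visited with probability zero. *)
Lemma total_factor t A (E : set T) :
  measurable A -> measurable [set w | E (Y t w)] ->
  P (A `&` [set w | E (Y t w)]) = \esum_(x in Sigma `&` E) P (A `&` [set w | Y t w = x]).
Proof.
move=> mA mE.
have cSE : countable (Sigma `&` E).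
  exact: sub_countable (subset_card_le (@subIsetl _ _ _)) factor_states_countable.
have [mSE <-] := sum_factor t cSE mA.
apply: ae_eq_measure => //; first exact: measurableI.
apply: negligibleS (factor_in_states t) => w /= nAE Sw; apply: nAE.
by split => [[Aw Ew]|[Aw [_ Ew]]].
Qed.

Lemma transition_matrix_ge0 x y : 0 <= Q x y.
Proof. by rewrite /transition_matrix/cond_prob divr_ge0// fine_ge0. Qed.

Lemma transition_matrixE x y : Sigma x -> (Q x y)%:E = step_prob x y.
Proof.
move=> Sx; rewrite /transition_matrix/cond_prob.
have mx := measurable_factor 0 x.
have p0 : past 0 [set w | Y 0 w = x] by exact: past_factor.
have := @markov_step 0 _ x y p0 (@subset_refl _ _).
rewrite add0r setIC => ->.
have mq : measurable [set w | Phi x (xi 0 w) = y].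
  have [mxi _ _] := xi_iid; exact: mxi (Phi_meas x y).
rewrite /step_prob fineM ?fin_num_measure// [X in X / _]mulrC mulfK ?fineK ?fin_num_measure//.
by rewrite fine_eq0 ?fin_num_measure// gt_eqF.
Qed.

Lemma markov_transition t A x y : Sigma x -> past t A -> A `<=` [set w | Y t w = x] ->
  P (A `&` [set w | Y (t + 1) w = y]) = (P A * (Q x y)%:E)%E.
Proof. by move=> Sx pA Ax; rewrite transition_matrixE// (markov_step _ pA Ax). Qed.

Lemma factor_states_past t A x : past t A -> A `<=` [set w | Y t w = x] ->
  (0 < P A)%E -> Sigma x.
Proof.
move=> pA Ax PA; rewrite /factor_states/= -(prob_factor t).
apply: (lt_le_trans PA); rewrite le_measure ?inE//.
  exact: measurable_past pA.
exact: measurable_factor.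
Qed.

Lemma factor_stochastic : stochastic_matrix Sigma Q.
Proof.
split => [x y _ _|x Sx]; first exact: transition_matrix_ge0.
have p0 : past 0 [set w | Y 0 w = x] by exact: past_factor.
have m0 := measurable_past p0.
have := @total_factor 1 _ setT m0 measurableT.
rewrite !setIT.
under eq_esum => y _.
  rewrite -[1]add0r (markov_transition y Sx p0 (@subset_refl _ _)).
  rewrite -(fineK (fin_num_measure P _ m0)).
  over.
rewrite esumZl ?fine_ge0//; last by move=> y; rewrite lee_fin transition_matrix_ge0.
rewrite fineK ?fin_num_measure// -[X in X = _]mule1 => e.
by apply/esym; apply: mule_pI e => //; exact: fin_num_measure.
Qed.

Lemma factor_markov_chain : markov_chain P Y Sigma Q.
Proof.
split.
- exact: factor_states_countable.
- exact: factor_in_states.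
- exact: factor_stochastic.
move=> t n e y Sy Ppast.
have ppast : past t (past_event Y t n e).
  by apply: past_bigcap => k _; apply: past_factor; rewrite gerBl.
have past0 : past_event Y t n e `<=` [set w | Y t w = e 0%N].
  by move=> w /(_ 0%N) /=; rewrite subr0; exact.
have Se := factor_states_past ppast past0 Ppast.
have mpast := measurable_past ppast.
rewrite /cond_prob setIC (markov_transition y Se ppast past0).
rewrite fineM ?fin_num_measure//= [X in X / _]mulrC mulfK//.
by rewrite fine_eq0 ?fin_num_measure// gt_eqF.
Qed.

(** * Probabilities of n-step transitions and of first passages *)

Lemma matrix_power_ge0 n x y : (0 <= matrix_power Sigma Q n x y)%E.
Proof.
elim: n x => [|n IH] x /=; first by rewrite lee_fin ler0n.
by apply: esum_ge0 => z _; rewrite mule_ge0// lee_fin transition_matrix_ge0.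
Qed.

(** The event [A] is arbitrary so that the induction can replace it by its intersection with the
    event that the chain is at z at time t + 1, which belongs to [past (t + 1)]. *)
Lemma prob_matrix_power n t A x y : Sigma x -> past t A -> A `<=` [set w | Y t w = x] ->
  P (A `&` [set w | Y (t + n%:Z) w = y]) = (P A * matrix_power Sigma Q n x y)%E.
Proof.
elim: n t A x => [|n IH] t A x Sx pA Ax /=.
  rewrite addr0; have [<-|xy] := eqVneq x y.
    by rewrite mule1; congr (P _); apply/setIidPl.
  rewrite mule0; rewrite (_ : _ `&` _ = set0) ?measure0//.
  by apply/seteqP; split => // w [/Ax /= ->] /eqP; rewrite (negbTE xy).
have mA := measurable_past pA.
have tn : t + n.+1%:Z = t + 1 + n%:Z by rewrite intS addrA.
have my := measurable_factor (t + n.+1%:Z) y.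
rewrite -[in LHS](setIT (A `&` _)) (@total_factor (t + 1) _ setT); last 2 first.
- exact: measurableI.
- exact: measurableT.
rewrite setIT -(fineK (fin_num_measure P _ mA)) -esumZl ?fine_ge0//; last first.
  by move=> z; rewrite mule_ge0// ?matrix_power_ge0// lee_fin transition_matrix_ge0.
apply: eq_esum => z Sz; rewrite fineK ?fin_num_measure// muleA.
rewrite -(markov_transition z Sx pA Ax).
have pAz : past (t + 1) (A `&` [set w | Y (t + 1) w = z]).
  apply: pastI; last exact: past_factor.
  by apply: past_sub pA; rewrite lerDl.
rewrite -(IH _ _ z Sz pAz); last by move=> w [].
by rewrite tn setIAC.
Qed.

(** It is empty for n = 0, in agreement with the value 0 of [first_passage] there. *)
Definition first_hit (t : int) (n : nat) (y : T) : set Omega :=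
  [set w | [/\ (0 < n)%N, Y (t + n%:Z) w = y &
            forall i, (0 < i < n)%N -> Y (t + i%:Z) w <> y]].

Lemma measurable_first_hit t n y : measurable (first_hit t n y).
Proof.
case: n => [|n].
  by rewrite (_ : first_hit _ _ _ = set0)//; apply/seteqP; split => // w [].
apply: (@measurable_past (t + n.+1%:Z)).
rewrite (_ : first_hit _ _ _ = [set w | Y (t + n.+1%:Z) w = y] `&`
  \bigcap_(i in [set i | (0 < i < n.+1)%N]) ~` [set w | Y (t + i%:Z) w = y]).
  apply: pastI; first exact: past_factor.
  apply: past_bigcap => i /= /andP[_ ltin]; apply: pastC; apply: past_factor.
  by rewrite lerD2l lez_nat ltnW.
by apply/seteqP; split => [w [_ ? ?]|w [? ?]].
Qed.

Lemma first_passageSS n x y : first_passage Sigma Q n.+2 x y =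
  (\esum_(z in Sigma `\ y) ((Q x z)%:E * first_passage Sigma Q n.+1 z y))%E.
Proof. by []. Qed.

Lemma first_passage_ge0 n x y : (0 <= first_passage Sigma Q n x y)%E.
Proof.
elim: n x => [|[|n] IH] x; first by [].
  by rewrite lee_fin transition_matrix_ge0.
rewrite first_passageSS; apply: esum_ge0 => z _.
by rewrite mule_ge0// lee_fin transition_matrix_ge0.
Qed.

(** First-step decomposition: for n at least 2, time t + 1 must avoid y, whence the sum over [Sigma]
    without y; the remainder is a first hit counted from t + 1. *)
Lemma prob_first_passage n t A x y : Sigma x -> past t A -> A `<=` [set w | Y t w = x] ->
  P (A `&` first_hit t n y) = (P A * first_passage Sigma Q n x y)%E.
Proof.
have hit1 s : first_hit s 1 y = [set w | Y (s + 1) w = y].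
  apply/seteqP; split => [w []//|w Yw]; split => // i.
  by rewrite ltnS; case: i.
elim: n t A x => [|n IH] t A x Sx pA Ax.
  rewrite mule0 (_ : _ `&` _ = set0) ?measure0//.
  by apply/seteqP; split => // w [_ []].
case: n IH => [|n] IH; first by rewrite hit1 (markov_transition y Sx pA Ax).
have mA := measurable_past pA.
have shift1 i : t + i.+1%:Z = t + 1 + i%:Z by rewrite intS addrA.
have hitS : first_hit t n.+2 y =
    first_hit (t + 1) n.+1 y `&` [set w | (~` [set y]) (Y (t + 1) w)].
  apply/seteqP; split => [w [_ Yw Yi]|w [[_ Yw Yi] Y1]].
    split; last exact: (Yi 1%N).
    split => //; first by rewrite -shift1.
    by move=> i /andP[i0 ltin]; rewrite -shift1; apply: Yi; rewrite /= ltnS.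
  split => //; first by rewrite shift1.
  move=> [|[|i]] //= ltin; rewrite shift1.
  by apply: Yi; rewrite /= -ltnS.
rewrite hitS setIA total_factor; last 2 first.
- by apply: measurableI => //; exact: measurable_first_hit.
- by apply: measurableC; exact: measurable_factor.
rewrite -setDE first_passageSS.
rewrite -(fineK (fin_num_measure P _ mA)) -esumZl ?fine_ge0//; last first.
  by move=> z; rewrite mule_ge0 ?first_passage_ge0// lee_fin transition_matrix_ge0.
apply: eq_esum => z [Sz zy]; rewrite fineK ?fin_num_measure// muleA.
rewrite -(markov_transition z Sx pA Ax).
have pAz : past (t + 1) (A `&` [set w | Y (t + 1) w = z]).
  apply: pastI; last exact: past_factor.
  by apply: past_sub pA; rewrite lerDl.
rewrite -(IH _ _ z Sz pAz); last by move=> w [].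
by rewrite setIAC.
Qed.

(** The event of being at x, y, z at times 0, m, m + n has positive probability and implies being at
    x and z at times 0 and m + n. *)
Lemma matrix_power_gt0_trans m n x y z : Sigma x -> Sigma y ->
  (0 < matrix_power Sigma Q m x y)%E -> (0 < matrix_power Sigma Q n y z)%E ->
  (0 < matrix_power Sigma Q (m + n) x z)%E.
Proof.
move=> Sx Sy xy yz.
have p0 : past 0 [set w | Y 0 w = x] by exact: past_factor.
pose A := [set w | Y 0 w = x] `&` [set w | Y (0 + m%:Z) w = y].
have pA : past (0 + m%:Z) A.
  by apply: pastI; exact: past_factor.
have : (0 < P (A `&` [set w | Y (0 + m%:Z + n%:Z) w = z]))%E.
  rewrite (prob_matrix_power n z Sy pA); last by move=> w [].
  by rewrite (prob_matrix_power m y Sx p0 (@subset_refl _ _)) !mule_gt0.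
rewrite lt0e => /andP[nz _].
rewrite lt0e matrix_power_ge0 andbT; apply: contra_neq nz => mn0.
apply: (@subset_measure0 _ _ _ _ _
  ([set w | Y 0 w = x] `&` [set w | Y (0 + (m + n)%:Z) w = z])).
- by apply: measurableI (measurable_past pA) _; exact: measurable_factor.
- by apply: measurableI; exact: measurable_factor.
- by move=> w [[? _]]; rewrite PoszD addrA.
- by have := prob_matrix_power (m + n) z Sx p0 (@subset_refl _ _); rewrite mn0 mule0.
Qed.

(** * Recurrence of the chain *)

Definition hit (E : set int) (x : T) : set (int -> Xi) :=
  [set u | exists2 t, E t & beta (time_shift t u) = x].

Lemma coords_hit s E x : (forall t, E t -> t <= s) -> coords G [set i | i < s] (hit E x).
Proof.
move=> Es; rewrite (_ : hit E x =
    \bigcup_(t in E) (time_shift t @^-1` [set u | beta u = x])); last first.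
  by apply/seteqP; split => u [t Et ut]; exists t.
apply: coords_bigcup => t /Es ts.
apply: (coords_sub _ (coords_shift t (beta_past x))) => i /=.
by rewrite subr_lt0 => /lt_le_trans; apply.
Qed.

Lemma coordsT_hit E x : coords G setT (hit E x).
Proof.
rewrite (_ : hit E x =
    \bigcup_(t in E) (time_shift t @^-1` [set u | beta u = x])); last first.
  by apply/seteqP; split => u [t Et ut]; exists t.
by apply: coords_bigcup => t _; exact: coords_factor.
Qed.

Lemma measurable_hit E x : measurable (trajectory xi @^-1` hit E x).
Proof. exact: (measurable_trajectory G_sigma xi_iid (coordsT_hit E x)). Qed.

Lemma prob_hit_shift k E x :
  P (trajectory xi @^-1` hit [set t | E (t - k)] x) = P (trajectory xi @^-1` hit E x).
Proof.
rewrite -(trajectory_stationary G_sigma xi_iid k (coordsT_hit E x)).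
congr (P _); apply/seteqP; split => w /= [t Et tx].
  by exists (t - k) => //; rewrite time_shiftD subrK.
by exists (t + k); [rewrite /= addrK | rewrite -time_shiftD].
Qed.

(* The event that x is visited at arbitrarily remote past times lies in the
   tail and has the probability that x is visited at some time t <= 0. *)
Lemma prob_hit_past x : Sigma x ->
  P (trajectory xi @^-1` (\bigcap_(n : nat) hit [set t | t <= - n%:Z] x)) = 1%E.
Proof.
move=> Sx; set M := \bigcap_n _.
pose c := P (trajectory xi @^-1` hit [set t : int | t <= 0] x).
have PM : P (trajectory xi @^-1` M) = c.
  rewrite preimage_bigcap; apply: nonincreasing_cst_prob.
  - by move=> n; exact: measurable_hit.
  - move=> n w [t /= tn tx]; exists t => //=; apply: le_trans tn _.
    by rewrite lerN2 lez_nat.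
  - move=> n; rewrite /c -(prob_hit_shift (- n%:Z) [set t | t <= 0]).
    congr (P (_ @^-1` hit _ _)).
    by apply/seteqP; split => t /=; rewrite opprK -[t <= - _]subr_le0 opprK.
have c0 : (0 < c)%E.
  apply: (lt_le_trans Sx); rewrite le_measure ?inE//.
  - exact: measurable_factor.
  - exact: measurable_hit.
  - by move=> w /= wx; exists 0.
have pM t : coords G [set i | i < t] M.
  rewrite (_ : M = \bigcap_(n in [set n : nat | - n%:Z <= t]) hit [set t | t <= - n%:Z] x).
    apply: coords_bigcap => n /= nt; apply: coords_hit => s /= sn.
    exact: le_trans sn nt.
  apply/seteqP; split => u uM n; first by move=> _; exact: uM.
  (* This index satisfies the restriction - n <= t and gives an earlier visit than index n asks
     for. *)
  move=> _; have [] := uM (n + `|t|)%N.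
    rewrite /= PoszD opprD; apply: le_trans (_ : - `|t|%:Z <= t).
      by rewrite gerDr oppr_le0.
    by rewrite abszE lerNl -normrN ler_norm.
  move=> s /= sn sx; exists s => //=; apply: le_trans sn _.
  by rewrite lerN2 lez_nat leq_addr.
by have [] := zero_one_past G_sigma xi_iid pM; rewrite PM => // c00; move: c0; rewrite c00 ltxx.
Qed.

(** By stationarity the probability of a visit at or after k does not depend on k. As k tends to
    minus infinity these events increase to a visit at some time, which is almost sure by
    [prob_hit_past]; as k tends to plus infinity they decrease to infinitely many future visits. *)
Lemma prob_hit_future x : Sigma x ->
  P (trajectory xi @^-1` (\bigcap_(n : nat) hit [set t | n%:Z <= t] x)) = 1%E.
Proof.
move=> Sx.
pose c := P (trajectory xi @^-1` hit [set t : int | 0 <= t] x).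
have Pc k : P (trajectory xi @^-1` hit [set t : int | k <= t] x) = c.
  rewrite /c -(prob_hit_shift k [set t | 0 <= t]).
  by congr (P (_ @^-1` hit _ _)); apply/seteqP; split => t /=; rewrite subr_ge0.
have c1 : c = 1%E.
  have <- : P (\bigcup_n (trajectory xi @^-1` hit [set t : int | - n%:Z <= t] x)) = c.
    apply: nondecreasing_cst_prob => //.
    - by move=> n; exact: measurable_hit.
    - move=> n w [t /= tn tx]; exists t => //=; apply: le_trans tn.
      by rewrite lerN2 lez_nat.
  apply/eqP; rewrite eq_le probability_le1//=; last first.
    by apply: bigcup_measurable => n _; exact: measurable_hit.
  rewrite -(prob_hit_past Sx) le_measure ?inE//.
  - rewrite preimage_bigcap; apply: bigcapT_measurable => n; exact: measurable_hit.
  - by apply: bigcup_measurable => n _; exact: measurable_hit.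
  - move=> w /(_ 0%N Logic.I) [t _ tx]; exists `|t|%N => //; exists t => //=.
    by rewrite abszE lerNl -normrN ler_norm.
rewrite preimage_bigcap; apply: nonincreasing_cst_prob.
- by move=> n; exact: measurable_hit.
- move=> n w [t /= tn tx]; exists t => //=; apply: le_trans tn.
  by rewrite lez_nat.
- by move=> n; rewrite Pc.
Qed.

Lemma factor_bi_recurrent x : Sigma x -> bi_recurrent P Y x.
Proof.
move=> Sx.
have mb (F : nat -> set int) :
    measurable (trajectory xi @^-1` (\bigcap_n hit (F n) x)).
  by rewrite preimage_bigcap; apply: bigcapT_measurable => n; exact: measurable_hit.
have aep := ae_prob1 (mb _) (prob_hit_past Sx).
have aef := ae_prob1 (mb _) (prob_hit_future Sx).
apply: negligibleS (negligibleU aep aef) => w /= /not_andP[|] /contrapT[b bb].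
- right => /= /(_ (`|b|.+1) Logic.I) [t /= bt tx].
  have := bb _ tx; rewrite leNgt => /negP; apply.
  by apply: lt_le_trans bt; rewrite -addn1 PoszD ltzD1 abszE ler_norm.
- left => /= /(_ (`|b|.+1) Logic.I) [t /= bt tx].
  have := bb _ tx; rewrite leNgt => /negP; apply.
  apply: le_lt_trans bt _; rewrite ltrNl -addn1 PoszD ltzD1 abszE.
  by rewrite -normrN ler_norm.
Qed.

(** If y were inaccessible from x, then almost surely on the event of being at x at time 0 there
    would be no later visit to y, against bi-recurrence of y. *)
Lemma factor_irreducible : irreducible_matrix Sigma Q.
Proof.
move=> x y Sx Sy; apply: contrapT => nxy.
have p0 : past 0 [set w | Y 0 w = x] by exact: past_factor.
have null n : P ([set w | Y 0 w = x] `&` [set w | Y (0 + n.+1%:Z) w = y]) = 0%E.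
  rewrite (prob_matrix_power n.+1 y Sx p0 (@subset_refl _ _)).
  have [->|Mxy] := eqVneq (matrix_power Sigma Q n.+1 x y) 0%E; first by rewrite mule0.
  by exfalso; apply: nxy; exists n.+1 => //; rewrite lt0e Mxy matrix_power_ge0.
have negl : P.-negligible
    (\bigcup_n ([set w | Y 0 w = x] `&` [set w | Y (0 + n.+1%:Z) w = y])).
  apply: negligible_bigcup => n; apply/negligibleP; last exact: null.
  by apply: measurableI; exact: measurable_factor.
have : P.-negligible [set w | Y 0 w = x].
  apply: negligibleS (negligibleU negl (factor_bi_recurrent Sy)) => w /= wx.
  have [ub|nub] := pselect (has_ubound [set t | Y t w = y]); first by right; case.
  (* Without a visit to y at a positive time, 0 bounds the visit times from above. *)
  left; apply: contrapT => nhit; apply: nub; exists 0 => -[n|n] //= ny.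
  by case: n ny => // n ny; exfalso; apply: nhit; exists n => //; rewrite /= add0r.
move/(measure_negligible (measurable_factor 0 x)) => Px0.
by move: Sx; rewrite /factor_states/= [X in (_ < X)%E]Px0 ltxx.
Qed.

(** First hits at different times are disjoint, and bi-recurrence makes them exhaust the event of
    being at x at time 0, up to a null set. *)
Lemma first_passage_sum1 x : Sigma x ->
  (\sum_(0 <= n <oo) first_passage Sigma Q n x x = 1)%E.
Proof.
move=> Sx.
have p0 : past 0 [set w | Y 0 w = x] by exact: past_factor.
have m0 := measurable_past p0.
have mh n : measurable ([set w | Y 0 w = x] `&` first_hit 0 n x).
  by apply: measurableI => //; exact: measurable_first_hit.
apply: (@mule_pI _ (P [set w | Y 0 w = x])) => //; first exact: fin_num_measure.
rewrite -(fineK (fin_num_measure P _ m0)) -nneseriesZl; last first.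
  by move=> n _; exact: first_passage_ge0.
rewrite fineK ?fin_num_measure// mule1.
under eq_eseriesr do
  rewrite -(prob_first_passage _ _ Sx p0 (@subset_refl _ _)).
rewrite -measure_semi_bigcup//; last 2 first.
- move=> i j _ _ [w [[_ [i0 wi ni]] [_ [j0 wj nj]]]].
  have [ij|ji|//] := ltngtP i j.
    by exfalso; apply: (nj i) => //; rewrite i0.
  by exfalso; apply: (ni j) => //; rewrite j0.
- by apply: bigcup_measurable => n _; exact: mh.
apply: ae_eq_measure => //; first by apply: bigcup_measurable => n _; exact: mh.
apply: negligibleS (factor_bi_recurrent Sx) => w /= nw [nub _].
apply: nw; split => [[n _ [wx _]]//|wx].
have [n n0 wn] : exists2 n : nat, (0 < n)%N & Y n%:Z w = x.
  apply: contrapT => nn; apply: nub; exists 0 => -[n|n] //= wn.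
  by case: n wn => // n wn; exfalso; apply: nn; exists n.+1.
have ex : exists n : nat, (0 < n)%N && (Y n%:Z w == x).
  by exists n; rewrite n0 wn eqxx.
have [m /andP[mpos /eqP wm] mmin] := ex_minnP ex.
exists m => //; split => //; split; rewrite ?add0r// => i /andP[i0 im] /eqP wi.
by have := mmin i; rewrite i0 -[i%:Z]add0r wi => /(_ isT); rewrite leqNgt im.
Qed.

(* Kac: n P(Y_0 = x, return time n) is the total probability of the disjoint
   events "last visit before time 1 at -k, next one at n - k", k < n. *)
Lemma mean_first_passage_finite x : Sigma x ->
  (\sum_(0 <= n <oo) (n%:R%:E * first_passage Sigma Q n x x) < +oo)%E.
Proof.
move=> Sx.
have mx := measurable_factor 0 x.
have px k : past (- k%:Z) [set w | Y (- k%:Z) w = x] by exact: past_factor.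
pose K n k := [set w | Y (- k%:Z) w = x] `&` first_hit (- k%:Z) n x.
have mK n k : measurable (K n k).
  by apply: measurableI; [exact: measurable_factor|exact: measurable_first_hit].
(* Both gaps between visits straddle time 0. If k < k', the visit at -k would fall strictly inside
   the gap that starts at -k'. *)
have KK n k n' k' w : (k < n)%N -> (k' < n')%N -> K n k w -> K n' k' w -> (k' <= k)%N.
  move=> kn k'n' [/= wk _] [_ [_ _ nh]]; rewrite leqNgt; apply/negP => kk'.
  apply: (nh (k' - k)%N).
    by rewrite subn_gt0 kk' (leq_ltn_trans (leq_subr _ _) k'n').
  by rewrite -(subzn (ltnW kk')) addKr.
pose U n := \bigcup_(k in `I_n) K n k.
have PU n : P (U n) = (P [set w | Y 0 w = x] * (n%:R%:E * first_passage Sigma Q n x x))%E.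
  rewrite /U bigcup_mkord measure_bigsetU_ord//=; last first.
    move=> i j _ _ [w [wi wj]]; apply/val_inj/eqP => /=.
    by rewrite eqn_leq (KK _ _ _ _ _ _ _ wj wi)// (KK _ _ _ _ _ _ _ wi wj).
  under eq_bigr => k _.
    rewrite (prob_first_passage n x Sx (px k) (@subset_refl _ _)) prob_factor.
    over.
  by rewrite sumr_const card_ord muleCA mule_natl.
have mU n : measurable (U n) by apply: bigcup_measurable.
have tU : trivIset setT U.
  move=> n n' _ _ [w [[k /= kn wk] [k' /= kn' wk']]].
  have ekk : k = k'.
    by apply/eqP; rewrite eqn_leq (KK _ _ _ _ _ _ _ wk' wk)// (KK _ _ _ _ _ _ _ wk wk').
  move: wk wk'; rewrite -ekk => -[_ [n0 wn hn]] [_ [n0' wn' hn']].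
  have [nn|nn|//] := ltngtP n n'.
    by exfalso; apply: (hn' n) => //; rewrite n0.
  by exfalso; apply: (hn n') => //; rewrite n0'.
have PU1 : (\sum_(0 <= n <oo) P (U n) <= 1)%E.
  rewrite -measure_semi_bigcup//; last exact: bigcup_measurable.
  by apply: probability_le1; exact: bigcup_measurable.
pose p := fine (P [set w | Y 0 w = x]).
have p0 : 0 < p by rewrite fine_gt0// Sx ltey_eq fin_num_measure.
apply: (@le_lt_trans _ _ (p^-1%:E * 1)%E); last by rewrite mule1 ltry.
rewrite lee_pdivlMl// -nneseriesZl; last first.
  by move=> n _; rewrite mule_ge0 ?first_passage_ge0// lee_fin ler0n.
apply: le_trans PU1; rewrite le_eqVlt; apply/orP; left; apply/eqP.
by apply: eq_eseriesr => n _; rewrite PU /p fineK// fin_num_measure.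
Qed.

Lemma factor_positive_recurrent : positive_recurrent_matrix Sigma Q.
Proof.
move=> x Sx; split; first exact: first_passage_sum1.
exact: mean_first_passage_finite.
Qed.

(** Go from y to x, take the loop at x or not, and return: a common divisor of the return times of y
    divides both m + n and m + 1 + n, hence 1. *)
Lemma factor_aperiodic x : Sigma x -> 0 < Q x x -> aperiodic_matrix Sigma Q.
Proof.
move=> Sx Qxx y Sy.
have [m m0 Myx] := factor_irreducible Sy Sx.
have [n n0 Mxy] := factor_irreducible Sx Sy.
have M1 : (0 < matrix_power Sigma Q 1 x x)%E.
  have p0 : past 0 [set w | Y 0 w = x] by exact: past_factor.
  have := prob_matrix_power 1 x Sx p0 (@subset_refl _ _).
  rewrite (markov_transition x Sx p0 (@subset_refl _ _)).
  move=> e; rewrite -(mule_pI _ Sx e) ?lte_fin//.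
  by rewrite fin_num_measure//; exact: measurable_factor.
split => // k kdvd.
have d1 : (k %| m + n)%N.
  by apply: kdvd; rewrite /= addn_gt0 m0; split => //; exact: (matrix_power_gt0_trans Sy Sx).
have : (k %| m + (1 + n))%N.
  apply: kdvd; rewrite /= addn_gt0 m0; split => //.
  by apply: (matrix_power_gt0_trans Sy Sx) => //; exact: (matrix_power_gt0_trans Sx Sx).
by rewrite addnCA dvdn_addl.
Qed.

End factor_chain.

(** * The bridge graph *)

Section flow.
Context (S : countType) (Xi : Type).
Variable h : S * Xi -> S.

(** The map [f_plus] with the sample point replaced by a trajectory, so that time shifts act on
    it. *)
Definition flow_step (u : int -> Xi) (v : int * S) : int * S :=
  (v.1 + 1, h (v.2, u v.1)).

Definition flow_iter (u : int -> Xi) (v : int * S) (n : nat) : int * S :=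
  iter n (flow_step u) v.

Lemma flow_iter_time u v n : (flow_iter u v n).1 = v.1 + n%:Z.
Proof.
elim: n => [|n IH]; first by rewrite addr0.
by rewrite /flow_iter iterS /= -/(flow_iter u v n) IH -addrA -PoszD addn1.
Qed.

Lemma flow_iterS u a x n :
  (flow_iter u (a, x) n.+1).2 = h ((flow_iter u (a, x) n).2, u (a + n%:Z)).
Proof.
by rewrite /flow_iter iterS -/(flow_iter _ _ n) /flow_step /= flow_iter_time.
Qed.

Lemma flow_iterD u v m n : flow_iter u v (m + n) = flow_iter u (flow_iter u v m) n.
Proof. by rewrite /flow_iter addnC iterD. Qed.

Lemma flow_iter_from u a x m n y : (flow_iter u (a, x) m).2 = y ->
  (flow_iter u (a, x) (m + n)).2 = (flow_iter u (a + m%:Z, y) n).2.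
Proof.
by move=> <-; rewrite flow_iterD; have := flow_iter_time u (a, x) m;
  case: (flow_iter u (a, x) m) => b z /= ->.
Qed.

Lemma flow_iter_shift k u a x n :
  (flow_iter (time_shift k u) (a, x) n).2 = (flow_iter u (a + k, x) n).2.
Proof.
suff -> : flow_iter u (a + k, x) n =
  ((flow_iter (time_shift k u) (a, x) n).1 + k, (flow_iter (time_shift k u) (a, x) n).2).
  by [].
elim: n => [//|n IH]; rewrite /flow_iter !iterS -!/(flow_iter _ _ n) IH.
by rewrite /flow_step /= addrAC.
Qed.

Variable xstar : S.

(** The bridge at time 0 as a deterministic function of the driving sequence: n is the age of the
    path from x*. *)
Definition canonical_bridge (u : int -> Xi) : set S :=
  [set y | exists n : nat, (flow_iter u (- n%:Z, xstar) n).2 = y].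

Definition bridge_step (E : set S) (v : Xi) : set S :=
  [set xstar] `|` [set h (z, v) | z in E].

(** After the shift the path of age 0 contributes x*, and the path of age n + 1 is the old path of
    age n extended by one step at time 0. *)
Lemma canonical_bridge_step u :
  canonical_bridge (time_shift 1 u) = bridge_step (canonical_bridge u) (u 0).
Proof.
have iterS1 n : (flow_iter (time_shift 1 u) (- n.+1%:Z, xstar) n.+1).2 =
    h ((flow_iter u (- n%:Z, xstar) n).2, u 0).
  by rewrite flow_iter_shift intS opprD addrAC addNr add0r flow_iterS addNr.
apply/seteqP; split => y.
  move=> [[|n]]; first by move=> <-; left.
  by rewrite iterS1 => <-; right; exists (flow_iter u (- n%:Z, xstar) n).2 => //; exists n.
move=> [->|[z [n <-] <-]]; first by exists 0%N.
by exists n.+1; rewrite iterS1.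
Qed.

Variable G : set (set Xi).
Hypothesis G_sigma : sigma_algebra setT G.
Hypothesis h_meas : forall z y, G [set v | h (z, v) = y].

Lemma coords_flow_iter a x n y :
  coords G [set i | i < a + n%:Z] [set u | (flow_iter u (a, x) n).2 = y].
Proof.
elim: n y => [|n IH] y.
  have [xy|xy] := pselect (x = y).
    rewrite (_ : [set u | (flow_iter u (a, x) 0).2 = y] = setT).
      exact: coordsT.
    by apply/seteqP; split.
  rewrite (_ : [set u | (flow_iter u (a, x) 0).2 = y] = set0); last by apply/seteqP; split.
  by rewrite -setCT; apply: coordsC; exact: coordsT.
rewrite (_ : [set u | (flow_iter u (a, x) n.+1).2 = y] = \bigcup_(z in [set: S])
    ([set u | (flow_iter u (a, x) n).2 = z] `&` [set u | h (z, u (a + n%:Z)) = y])).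
  apply: coords_bigcup => z _; apply: coordsI.
    apply: (coords_sub _ (IH z)) => i /= lti; apply: (lt_le_trans lti).
    by rewrite lerD2l lez_nat.
  apply: (coords_coord (A := [set v | h (z, v) = y])) => //=.
  by rewrite ltrD2l ltz_nat.
apply/seteqP; split => u.
  move=> uy; exists (flow_iter u (a, x) n).2 => //; split => //=.
  by rewrite -flow_iterS.
by move=> [z _ [zE hE]]; have := flow_iterS u a x n; rewrite zE hE; exact.
Qed.

Lemma coords_canonical_bridge E :
  coords G [set i | i < 0] [set u | canonical_bridge u = E].
Proof.
apply: (salgebra_set_eq (coords_salgebra G _)) => y.
rewrite (_ : [set u | canonical_bridge u y] = \bigcup_(n in [set: nat])
    [set u | (flow_iter u (- n%:Z, xstar) n).2 = y]).
  apply: coords_bigcup => n _.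
  by have := @coords_flow_iter (- n%:Z) xstar n y; rewrite addNr.
by apply/seteqP; split => [u [n un]|u [n _ un]]; exists n.
Qed.

Lemma bridge_step_meas E E' : G [set v | bridge_step E v = E'].
Proof.
apply: (salgebra_set_eq G_sigma) => y.
have [->|yx] := eqVneq y xstar.
  rewrite (_ : [set v | bridge_step E v xstar] = setT); first exact: salgebraT.
  by apply/seteqP; split => // v _; left.
rewrite (_ : [set v | bridge_step E v y] = \bigcup_(z in E) [set v | h (z, v) = y]).
  by apply: salgebra_bigcup => // z _; exact: h_meas.
apply/seteqP; split => v; last by move=> [z Ez /= zy]; right; exists z.
by move=> [/eqP|[z Ez /= zy]]; [rewrite (negbTE yx) | exists z].
Qed.

End flow.
Arguments coords_flow_iter {S Xi h G} h_meas a x n y.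

Lemma negligible_bigcup_countType (R : realType) (d : measure_display)
    (Omega : measurableType d) (P : {measure set Omega -> \bar R})
    (I : countType) (F : I -> set Omega) :
  (forall i, P.-negligible (F i)) -> P.-negligible (\bigcup_i F i).
Proof.
move=> F0.
pose F' n := if unpickle n is Some i then F i else set0.
apply: (@negligibleS _ _ _ _ (\bigcup_n F' n)).
  by move=> w [i _ Fi]; exists (pickle i) => //; rewrite /F' pickleK.
apply: negligible_bigcup => n; rewrite /F'; case: unpickle => // .
exact: negligible_set0.
Qed.

Lemma ae_witness (R : realType) (d : measure_display)
    (Omega : measurableType d) (P : probability Omega R) (A Q : set Omega) :
  measurable A -> (0 < P A)%E -> (\forall w \ae P, Q w) -> exists2 w, A w & Q w.
Proof.
move=> mA PA aeQ; apply: contrapT => nAQ.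
suff : P.-negligible A.
  by move=> /(measure_negligible mA) PA0; move: PA; rewrite [X in (_ < X)%E]PA0 ltxx.
by apply: negligibleS aeQ => w Aw Qw; apply: nAQ; exists w.
Qed.

(** * The bridge as a factor chain: finiteness, and the singleton state *)

Section bridge_chain.
Context (R : realType) (d : measure_display) (Omega : measurableType d).
Variable P : probability Omega R.
Context (S : countType) (Xi : Type) (G : set (set Xi)).
Hypothesis G_sigma : sigma_algebra setT G.
Variable h : S * Xi -> S.
Hypothesis h_meas : forall z y, G [set v | h (z, v) = y].
Variable xi : int -> Omega -> Xi.
Hypothesis xi_iid : iid P G xi.
Variable xstar : S.

Definition no_return (s : int) (n : nat) : set (int -> Xi) :=
  [set u | forall i, (0 < i <= n)%N -> (flow_iter h u (s, xstar) i).2 <> xstar].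

(** The tail-sum form of a finite mean return time: the n-th term is the probability that the return
    to x* takes more than n steps. *)
Hypothesis return_integrable :
  (\sum_(0 <= n <oo) P (trajectory xi @^-1` no_return 0 n) < +oo)%E.

Local Notation bridge_at := (factor_process xi (canonical_bridge h xstar)).

Lemma coords_no_return s n : coords G setT (no_return s n).
Proof.
rewrite (_ : no_return s n = \bigcap_(i in [set i | (0 < i <= n)%N])
    ~` [set u | (flow_iter h u (s, xstar) i).2 = xstar]).
  apply: coords_bigcap => i _; apply: coordsC.
  exact: (coords_sub (@subsetT _ _) (coords_flow_iter h_meas s xstar i xstar)).
by apply/seteqP; split.
Qed.

Lemma measurable_no_return s n : measurable (trajectory xi @^-1` no_return s n).
Proof. exact: (measurable_trajectory G_sigma xi_iid (coords_no_return s n)). Qed.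

Lemma prob_no_return s n :
  P (trajectory xi @^-1` no_return s n) = P (trajectory xi @^-1` no_return 0 n).
Proof.
rewrite -(trajectory_stationary G_sigma xi_iid s (coords_no_return 0 n)).
by congr (P _); apply/seteqP; split => w wr i /wr; rewrite flow_iter_shift add0r.
Qed.

(** Borel-Cantelli; the starting time may vary with n because the probabilities are shift invariant.
    Starts at -n serve finiteness of the bridge, a fixed start serves recurrence of x*. *)
Lemma ae_lim_sup_no_return (s : nat -> int) : \forall w \ae P,
  exists N, forall n, (N <= n)%N -> ~ no_return (s n) n (trajectory xi w).
Proof.
pose F n := trajectory xi @^-1` no_return (s n) n.
have F0 : P (lim_sup_set F) = 0%E.
  apply: lim_sup_set_cvg0 => [n|]; first exact: measurable_no_return.
  rewrite (eq_eseriesr (g := fun n => P (trajectory xi @^-1` no_return 0 n)))// => n _.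
  exact: prob_no_return.
have mF : measurable (lim_sup_set F).
  apply: bigcapT_measurable => n; apply: bigcup_measurable => k _.
  exact: measurable_no_return.
have : P.-negligible (lim_sup_set F) by apply/negligibleP.
apply: negligibleS => w /= nN n _; apply: contrapT => nF; apply: nN.
by exists n => m nm Fm; apply: nF; exists m.
Qed.

Lemma ae_canonical_bridge_finite : \forall w \ae P, finite_set (bridge_at 0 w).
Proof.
apply: negligibleS (ae_lim_sup_no_return (fun n => - n%:Z)) => w /= nfin [N ret].
apply: nfin; rewrite /factor_process time_shift0; set u := trajectory xi w in ret *.
apply: (@sub_finite_set _ _ [set (flow_iter h u (- n%:Z, xstar) n).2 | n in `I_N]).
  (* For n >= N the path from -n returns to x* by time 0, so it ends where a younger path ends;
     descend until the age is below N. *)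
  move=> y [n <-]; elim/ltn_ind: n => n IH.
  have [nN|Nn] := ltnP n N; first by exists n.
  have [i [/andP[i0 lein] ui]] : exists i, (0 < i <= n)%N /\
      (flow_iter h u (- n%:Z, xstar) i).2 = xstar.
    apply: contrapT => nret; apply: (ret n Nn) => i i0n ui.
    by apply: nret; exists i.
  have := flow_iter_from (n - i) ui; rewrite subnKC// => ->.
  rewrite (_ : - n%:Z + i%:Z = - (n - i)%:Z); last by rewrite -subzn// opprB addrC.
  by apply: IH; rewrite ltn_subrL i0 (leq_trans i0).
exact/finite_image/finite_II.
Qed.

(* Iterate the almost sure first return. *)
Lemma ae_return_after0 : \forall w \ae P, forall n : nat, exists2 m, (n <= m)%N &
  (flow_iter h (trajectory xi w) (- n%:Z, xstar) m).2 = xstar.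
Proof.
have aeret : \forall w \ae P, forall n : nat, exists2 i, (0 < i)%N &
    (flow_iter h (trajectory xi w) (- n%:Z, xstar) i).2 = xstar.
  apply: (@negligibleS _ _ _ _ (\bigcup_(n : nat) ~` [set w |
      exists N, forall k, (N <= k)%N -> ~ no_return (- n%:Z) k (trajectory xi w)])).
    move=> w /= /existsNP[n nret]; exists n => //= -[N noret].
    apply: (noret N (leqnn N)) => i /andP[i0 _] ui.
    by apply: nret; exists i.
  by apply: negligible_bigcup => n; exact: ae_lim_sup_no_return (fun=> - n%:Z).
apply: negligibleS aeret => w /= nreg reg; apply: nreg => n.
elim/ltn_ind: n => n IH; have [i i0 ui] := reg n.
have [ni|lin] := leqP n i; first by exists i.
have [|m nim um] := IH (n - i)%N; first by rewrite ltn_subrL i0 (leq_trans i0 (ltnW lin)).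
exists (i + m)%N; first by rewrite -leq_subLR.
rewrite (flow_iter_from m ui) (_ : - n%:Z + i%:Z = - (n - i)%:Z)//.
by rewrite -subzn ?(ltnW lin)// opprB addrC.
Qed.

(** * Leading every point of a state to x* *)

Fixpoint reaches (n : nat) (y : S) : Prop :=
  if n is m.+1 then
    exists2 z, (0 < P [set w | h (y, xi 0 w) = z])%E & reaches m z
  else y = xstar.

Let measurable_h t z y : measurable [set w | h (z, xi t w) = y].
Proof. by have [mxi _ _] := xi_iid; exact: mxi (h_meas z y). Qed.

(** There are only countably many triples (time, source, target), so almost surely no transition of
    probability zero is ever realised. *)
Lemma ae_positive_transitions : \forall w \ae P, forall (t : int) (z : S),
  (0 < P [set w' | h (z, xi 0 w') = h (z, xi t w)])%E.
Proof.
apply: (@negligibleS _ _ _ _ (\bigcup_(p : int * S * S)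
    (if P [set w | h (p.1.2, xi 0 w) = p.2] == 0%E
     then [set w | h (p.1.2, xi p.1.1 w) = p.2] else set0))).
  move=> w /= /existsNP[t /existsNP[z /negP]].
  rewrite -leNgt measure_le0 => P0.
  by exists (t, z, h (z, xi t w)) => //=; rewrite [X in X == _](eqP P0) eqxx.
apply: negligible_bigcup_countType => -[[t z] y] /=.
case: ifPn => [/eqP P0|_]; last exact: negligible_set0.
apply/negligibleP; first exact: measurable_h.
by have [_ _ eqd] := xi_iid; rewrite -[RHS]P0; exact: (eqd t 0 _ (h_meas z y)).
Qed.

Lemma reaches_of_flow w s y n :
  (forall (t : int) (z : S), (0 < P [set w' | h (z, xi 0 w') = h (z, xi t w)])%E) ->
  (flow_iter h (trajectory xi w) (s, y) n).2 = xstar -> reaches n y.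
Proof.
move=> pos; elim: n s y => [//|n IH] s y un /=.
exists (h (y, xi s w)); first exact: pos.
by apply: (IH (s + 1)); rewrite -un /flow_iter iterSr.
Qed.

Local Notation SB := (factor_states P xi (canonical_bridge h xstar)).

Let cb_past := @coords_canonical_bridge S Xi h xstar G h_meas.
Let cb_step_meas := @bridge_step_meas S Xi h xstar G G_sigma h_meas.
Let cb_step := @canonical_bridge_step S Xi h xstar.

Lemma bridge_states_reach E y : SB E -> E y -> exists n, reaches n y.
Proof.
move=> SE Ey.
have mE := measurable_factor G_sigma xi_iid cb_past 0 E.
have [w /= wE [ret pos]] := ae_witness mE SE
  (filterI ae_return_after0 ae_positive_transitions).
move: Ey; rewrite -wE /factor_process time_shift0 => -[n un].
(* As m >= n, this return occurs at or after time 0, when the path is at y. *)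
have [m nm um] := ret n.
exists (m - n)%N; apply: (@reaches_of_flow w 0) => //.
by rewrite -um -{2}(subnKC nm) (flow_iter_from (m - n) un) addNr.
Qed.

Lemma bridge_states_finite E : SB E -> finite_set E.
Proof.
move=> SE; have mE := measurable_factor G_sigma xi_iid cb_past 0 E.
by have [w /= <-] := ae_witness mE SE ae_canonical_bridge_finite.
Qed.

Lemma bridge_states_xstar E : SB E -> E xstar.
Proof.
move=> SE; have mE := measurable_factor G_sigma xi_iid cb_past 0 E.
by have [w /= <- _] := ae_witness mE SE ae_canonical_bridge_finite; exists 0%N.
Qed.

Lemma countable_finite_sets : countable [set E : set S | finite_set E].
Proof.
have := countable_finite_subset (countableP [set: S]).
by apply: sub_countable; apply: subset_card_le => E; split.
Qed.

Lemma bridge_states_nonempty : exists E, SB E.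
Proof.
have PT : (0 < P setT)%E by rewrite probability_setT lte01.
have [w _ SEw] := ae_witness measurableT PT (factor_in_states G_sigma xi_iid cb_past
  countable_finite_sets ae_canonical_bridge_finite 0).
by exists (bridge_at 0 w).
Qed.

(** The step gives [E'] positive mass at time 1, and stationarity moves it to time 0. *)
Lemma bridge_states_step E E' : SB E ->
  (0 < step_prob P xi (bridge_step h xstar) E E')%E -> SB E'.
Proof.
move=> SE stepE.
have p0 : past G xi 0 [set w | bridge_at 0 w = E] by exact: past_factor.
have := markov_step G_sigma xi_iid cb_step_meas cb_step E' p0 (@subset_refl _ _).
rewrite add0r => PE.
rewrite /factor_states/= -(prob_factor G_sigma xi_iid cb_past 1).
apply: (@lt_le_trans _ _ (P ([set w | bridge_at 0 w = E] `&` [set w | bridge_at 1 w = E']))).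
  by rewrite PE mule_gt0.
rewrite le_measure ?inE//; last exact: (measurable_factor G_sigma xi_iid cb_past).
by apply: measurableI; exact: (measurable_factor G_sigma xi_iid cb_past).
Qed.

Hypothesis h_indep : independent P [set: set S] (fun x w => h (x, xi 0 w)).

(** If each y in [E] moves to g(y), the new bridge is x* together with the image of [E]; by
    independence this has probability at least a finite product of positive factors. *)
Lemma bridge_step_gt0 (E : set S) (g : S -> S) : finite_set E ->
  (forall y, E y -> 0 < P [set w | h (y, xi 0 w) = g y])%E ->
  (0 < step_prob P xi (bridge_step h xstar) E ([set xstar] `|` g @` E))%E.
Proof.
move=> /finite_seqP[s Es] pos.
have Eu : E = [set` undup s] by rewrite Es; apply/seteqP; split => y /=; rewrite mem_undup.
have := h_indep (B := fun y => [set g y]) (undup_uniq s) (fun=> Logic.I).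
set A := \bigcap_(i in _) _ => PA.
have mA : measurable A by apply: fin_bigcap_measurable => // y _; exact: measurable_h.
apply: (@lt_le_trans _ _ (P A)).
  rewrite PA big_seq; apply: (big_ind (fun x => 0 < x)%E) => //.
    by move=> a b; exact: mule_gt0.
  by move=> y sy; apply: pos; rewrite Eu.
rewrite /step_prob le_measure ?inE//.
  by have [mxi _ _] := xi_iid; exact: mxi (cb_step_meas _ _).
move=> w Aw /=; rewrite /bridge_step Eu; congr (_ `|` _).
by apply/seteqP; split => _ [y sy <-]; exists y => //; have := Aw y sy.
Qed.

Hypothesis loop : (0 < P [set w | h (xstar, xi 0 w) = xstar])%E.

(** Induction on a common bound for the numbers of steps to x*. A bound replaces exact lengths,
    since points may reach x* at different times; those already there wait by means of the loop. *)
Lemma bridge_states_descent m E : SB E ->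
  (forall y, E y -> exists2 k, (k <= m)%N & reaches k y) -> SB [set xstar].
Proof.
elim: m E => [|m IH] E SE reachE.
  rewrite (_ : [set xstar] = E)//; apply/seteqP; split => [_ ->|y Ey].
    exact: bridge_states_xstar.
  by have [[|k]] := reachE y Ey.
(* The map [g] follows the first transition of a short path to x*, and the loop when the path has
   length 0. *)
have /choice[g Hg] : forall y, exists z, E y ->
    (0 < P [set w | h (y, xi 0 w) = z])%E /\ exists2 k, (k <= m)%N & reaches k z.
  move=> y; have [/reachE[[|k] km]|nEy] := pselect (E y); last by exists y.
    by move=> /= ->; exists xstar => _; split => //; exists 0%N.
  by move=> [z pz rz]; exists z => _; split => //; exists k.
apply: (IH ([set xstar] `|` g @` E)).
  apply: (bridge_states_step SE); apply: bridge_step_gt0.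
    exact: bridge_states_finite.
  by move=> y /Hg[].
by move=> _ [->|[y /Hg[_ ?] <-]] //; exists 0%N.
Qed.

Lemma bridge_states_singleton : SB [set xstar].
Proof.
have [E SE] := bridge_states_nonempty.
have /choice[k Hk] : forall y, exists k, E y -> reaches k y.
  move=> y; have [/(bridge_states_reach SE)[k]|nEy] := pselect (E y); last by exists 0%N.
  by exists k.
have /finite_seqP[s Es] := bridge_states_finite SE.
apply: (@bridge_states_descent (\max_(y <- s) k y) E SE) => y Ey.
exists (k y); last exact: Hk.
by apply: leq_bigmax_seq => //; move: Ey; rewrite Es.
Qed.

Lemma bridge_matrix_loop : 0 < transition_matrix P bridge_at [set xstar] [set xstar].
Proof.
rewrite -lte_fin.
rewrite (transition_matrixE G_sigma xi_iid cb_past cb_step_meas cb_step _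
  bridge_states_singleton).
apply: (lt_le_trans loop); rewrite /step_prob le_measure ?inE//.
- by have [mxi _ _] := xi_iid; exact: mxi (cb_step_meas _ _).
- move=> w /= hw; apply/seteqP; split => [y [//|[_ -> <-]]|y ->]; last by left.
  by rewrite hw.
Qed.

End bridge_chain.

Section monotone_integral.
Local Open Scope ereal_scope.

(** The integral of a nonnegative function is a supremum over the simple functions below it, so
    monotonicity holds without measurability. It is applied with [return_time] as the upper
    function. *)
Lemma ge0_le_integral_nonmeasurable (R : realType) (d : measure_display)
    (Omega : measurableType d) (mu : {measure set Omega -> \bar R})
    (f g : Omega -> \bar R) :
  (forall w, 0 <= f w) -> (forall w, f w <= g w) ->
  \int[mu]_w f w <= \int[mu]_w g w.
Proof.
move=> f0 fg; rewrite !ge0_integralTE//; last by move=> w; exact: le_trans (fg w).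
apply: le_ereal_sup => _ [k /= kf <-]; exists k => //= w.
exact: le_trans (fg w).
Qed.

End monotone_integral.

(** * From the Doeblin graph to canonical trajectories *)

Section doeblin.
Context (R : realType) (d : measure_display) (Omega : measurableType d).
Variable P : probability Omega R.
Context (S : countType) (Xi : topologicalType).
Variables (h : S * Xi -> S) (xi : int -> Omega -> Xi).
Hypothesis h_measurable :
  measurable_map (product_salgebra [set: set S] (@borel Xi)) [set: set S] h.
Hypothesis xi_iid : iid P (@borel Xi) xi.

Lemma borel_salgebra : sigma_algebra setT (@borel Xi).
Proof. exact: smallest_sigma_algebra. Qed.

Lemma section_measurable z y : borel [set v | h (z, v) = y].
Proof.
apply: (@preimage_g_sigma_algebra _ _ (pair z) open _ _ _ (h_measurable (B := [set y]) I)).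
move=> _ [A _ [B mB <-]].
have [Az|nAz] := pselect (A z).
  by rewrite (_ : _ @^-1` _ = B)//; apply/seteqP; split => [v []|v].
rewrite (_ : _ @^-1` _ = set0); last by apply/seteqP; split => // v [].
by have [] := borel_salgebra.
Qed.

(** For any return time s, the terms with n >= s vanish and the s remaining ones are at most 1. The
    bound holds for every such s, hence for the infimum. *)
Lemma no_return_series_le x w :
  (\sum_(0 <= n <oo) (\1_(trajectory xi @^-1` no_return h x 0 n) w)%:E <=
   return_time R h xi x w)%E.
Proof.
apply: le_ereal_inf_tmp => _ [s [s0 sx] <-].
case: s s0 sx => // s s0 sx.
rewrite (nneseries_split 0 s)//.
rewrite [X in (_ + X)%E]eseries0 ?adde0; last first.
  move=> n; rewrite add0n => sn _; rewrite indicE memNset// => /(_ s); apply.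
    by rewrite sn andbT.
  by move: sx; rewrite /flow subr0.
apply: (@le_trans _ _ (\sum_(0 <= n < 0 + s) 1)%E).
  apply: lee_sum => n _; rewrite lee_fin indicE.
  by case: (_ \in _).
rewrite sumr_const_nat subn0 add0n.
by rewrite -(mule1 (s%:~R)%:E) -pmulrn mule_natl.
Qed.

Lemma return_integrable x : positive_recurrent_state P h xi x ->
  (\sum_(0 <= n <oo) P (trajectory xi @^-1` no_return h x 0 n) < +oo)%E.
Proof.
apply: le_lt_trans.
have mD n : measurable (trajectory xi @^-1` no_return h x 0 n).
  exact: (measurable_no_return borel_salgebra section_measurable xi_iid).
have <- : (\int[P]_w (\sum_(0 <= n <oo)
    (\1_(trajectory xi @^-1` no_return h x 0 n) w)%:E) =
    \sum_(0 <= n <oo) P (trajectory xi @^-1` no_return h x 0 n))%E.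
  rewrite integral_nneseries//; last first.
    by move=> n; apply/measurable_EFinP; exact: measurable_indic.
  by apply: eq_eseriesr => n _; rewrite integral_indic// setIT.
apply: ge0_le_integral_nonmeasurable => w; last exact: no_return_series_le.
by apply: nneseries_ge0 => n _ _; rewrite lee_fin.
Qed.

Lemma bridge_canonical x :
  bridge h xi x = factor_process xi (canonical_bridge h x).
Proof.
apply/funext => t; apply/funext => w; apply/seteqP; split => y.
  move=> [s _ [t' /= st [<- <-]]].
  exists `|t' - s|%N; rewrite flow_iter_shift gez0_abs ?subr_ge0//.
  by rewrite opprB subrK.
move=> [n <-]; exists (t - n%:Z) => //; exists t; first by rewrite /= gerBl.
by rewrite flow_iter_shift [- _ + _]addrC /flow /= opprB addrC subrK.
Qed.

End doeblin.

Theorem proposition4p19 (R : realType) (d : measure_display)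
    (Omega : measurableType d) (P : probability Omega R)
    (S : countType) (Xi : metricType R)
    (Xi_complete : complete_space Xi) (Xi_separable : separable_space Xi)
    (h : S * Xi -> S)
    (h_measurable :
       measurable_map (product_salgebra [set: set S] (@borel Xi)) [set: set S] h)
    (xi : int -> Omega -> Xi) (xi_iid : iid P (@borel Xi) xi)
    (xstar : S) (xstar_pos_rec : positive_recurrent_state P h xi xstar) :
  let B := bridge h xi xstar in
  let SB := bridge_states P h xi xstar in
  let PB := bridge_matrix P h xi xstar in
  [/\ markov_chain P B SB PB,
      stationary P B,
      forall E, SB E -> bi_recurrent P B E,
      irreducible_matrix SB PB /\ positive_recurrent_matrix SB PB &
      as_connected P h xi -> fully_independent_transitions P h xi ->
      0 < trans_prob P h xi xstar xstar ->
      [/\ SB [set xstar], 0 < PB [set xstar] [set xstar] &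
          aperiodic_matrix SB PB]].
Proof.
have G_sigma := borel_salgebra Xi.
have h_meas := section_measurable h_measurable.
have int_ret := return_integrable h_measurable xi_iid xstar_pos_rec.
have cb_past := @coords_canonical_bridge S Xi h xstar _ h_meas.
have step_meas := @bridge_step_meas S Xi h xstar _ G_sigma h_meas.
have step := @canonical_bridge_step S Xi h xstar.
have countable_fin := countable_finite_sets S.
have ae_fin := ae_canonical_bridge_finite G_sigma h_meas xi_iid int_ret.
rewrite /bridge_states /bridge_matrix bridge_canonical.
split.
- exact: (factor_markov_chain G_sigma xi_iid cb_past step_meas step countable_fin ae_fin).
- exact: (factor_is_stationary G_sigma xi_iid cb_past).
- move=> E SE; exact: (factor_bi_recurrent G_sigma xi_iid cb_past SE).
- split.
    exact: (factor_irreducible G_sigma xi_iid cb_past step_meas step countable_fin ae_fin).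
  exact: (factor_positive_recurrent G_sigma xi_iid cb_past step_meas step countable_fin ae_fin).
move=> _ [_ f_indep] loop.
have h_indep : independent P [set: set S] (fun x w => h (x, xi 0 w)).
  (* Values of [f_plus] carry the next time; [C'] attaches it to the target states. *)
  move=> s C us _; pose C' (x : S) := [set (0 + 1 : int, y) | y in C x].
  have pre x : f_plus h xi ^~ (0, x) @^-1` C' x = (fun w => h (x, xi 0 w)) @^-1` C x.
    apply/seteqP; split => w; last by move=> Cw; exists (h (x, xi 0 w)).
    by move=> [y Cy /(congr1 snd) /= e]; rewrite /preimage/= -e.
  have := f_indep 0 s C' us (fun=> I).
  rewrite (eq_bigcapr (fun x _ => pre x)) => ->.
  by apply: eq_bigr => x _; rewrite pre.
have loop' : (0 < P [set w | h (xstar, xi 0%R w) = xstar])%E.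
  by rewrite lt0e measure_ge0 andbT; apply: contraTneq loop => e; rewrite /trans_prob e ltxx.
have S1 := bridge_states_singleton G_sigma h_meas xi_iid int_ret h_indep loop'.
have Q1 := bridge_matrix_loop G_sigma h_meas xi_iid int_ret h_indep loop'.
split => //.
exact: (factor_aperiodic G_sigma xi_iid cb_past step_meas step countable_fin ae_fin S1 Q1).
Qed.
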